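(* Let $s>\frac12$, $a_0\in L^\infty_{loc}(\mathbf C^d)$, $0<t_0<1$ and $t_1=\frac1{4(1-t_0)}$. Then the following is true: (1) if $|a_0(w)|\lesssim e^{r_0|w|^{1/s}}$ holds for some $r_0>0$, then $$\mathrm{Op}^{\mathrm{aw}}_{\mathfrak V}(a_0):\mathcal A_{0,(s,t_0)}(\mathbf C^d)\to\mathcal A_{0,(s,t_1)}(\mathbf C^d),\qquad\mathrm{Op}^{\mathrm{aw}}_{\mathfrak V}(a_0):\mathcal A_{0,(s,t_0)}'(\mathbf C^d)\to\mathcal A_{0,(s,t_1)}'(\mathbf C^d)$$ are continuous; (2) if $|a_0(w)|\lesssim e^{r_0|w|^{1/s}}$ holds for every $r_0>0$, then $$\mathrm{Op}^{\mathrm{aw}}_{\mathfrak V}(a_0):\mathcal A_{(s,t_0)}(\mathbf C^d)\to\mathcal A_{(s,t_1)}(\mathbf C^d),\qquad\mathrm{Op}^{\mathrm{aw}}_{\mathfrak V}(a_0):\mathcal A_{(s,t_0)}'(\mathbf C^d)\to\mathcal A_{(s,t_1)}'(\mathbf C^d)$$ are continuous.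
   Context: $(z,w)=\sum_jz_j\overline{w_j}$, $d\lambda$ is Lebesgue measure on $\mathbf C^d$, $A(\mathbf C^d)$ is the space of entire functions on $\mathbf C^d$, and $\lesssim$ means inequality up to a constant independent of $w$. The anti-Wick operator with symbol $a_0$ is $\mathrm{Op}^{\mathrm{aw}}_{\mathfrak V}(a_0)F(z)=\pi^{-d}\int_{\mathbf C^d}a_0(w)F(w)e^{(z-w,w)}\,d\lambda(w)$, $z\in\mathbf C^d$. For $s>\frac12$, $t>0$ and $r\in\mathbf R$, $\mathcal A_{s,t,r}(\mathbf C^d)$ is the Banach space of all $F\in A(\mathbf C^d)$ with $\|F\|_{\mathcal A_{s,t,r}}=\|F\cdot e^{-t|\cdot|^2+r|\cdot|^{1/s}}\|_{L^\infty}<\infty$. Set $$\mathcal A_{0,(s,t)}=\bigcap_{r>0}\mathcal A_{s,t,r},\qquad\mathcal A_{(s,t)}'=\bigcap_{r>0}\mathcal A_{s,t,-r}$$ with projective limit topologies, and $$\mathcal A_{(s,t)}=\bigcup_{r>0}\mathcal A_{s,t,r},\qquad\mathcal A_{0,(s,t)}'=\bigcup_{r>0}\mathcal A_{s,t,-r}$$ with inductive limit topologies. *)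

(* Defs.v *)
From HB Require Import structures.
From mathcomp Require Import all_boot all_order all_algebra ring lra.
From mathcomp Require Import all_classical all_reals all_analysis.
From mathcomp Require Import complex ess_sup_inf.

Set Implicit Arguments.
Unset Strict Implicit.
Unset Printing Implicit Defensive.

Import Order.TTheory GRing.Theory Num.Theory.
Import numFieldNormedType.Exports.

Local Open Scope classical_set_scope.
Local Open Scope ring_scope.

(* The topology of R[i] is the one given by its modulus, which takes its values
   in R[i] itself; differentiability over R[i] is complex differentiability. *)
HB.instance Definition _ (R : realType) := NormedModule.copy R[i] R[i]^o.

Section tuple_product_measure.
Local Open Scope ereal_scope.
Context d (T : measurableType d) (R : realType).
Variables (m : {sigma_finite_measure set T -> \bar R}) (n : nat).
Variable mn : {sigma_finite_measure set (n.-tuple T) -> \bar R}.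

Let cons_pair (p : T * n.-tuple T) : n.+1.-tuple T := [tuple of p.1 :: p.2].

Let measurable_cons_pair : measurable_fun setT cons_pair.
Proof. exact: measurable_cons. Qed.

Definition tuple_cons_measure : set (n.+1.-tuple T) -> \bar R :=
  pushforward (m \x mn) cons_pair.

Let tcm0 : tuple_cons_measure set0 = 0.
Proof. by rewrite /tuple_cons_measure /pushforward preimage_set0 measure0. Qed.

Let tcm_ge0 A : 0 <= tuple_cons_measure A.
Proof. exact: measure_ge0. Qed.

Let tcm_sigma_additive : semi_sigma_additive tuple_cons_measure.
Proof. by apply: measure_semi_sigma_additive. Qed.

HB.instance Definition _ := isMeasure.Build _ _ _ tuple_cons_measure
  tcm0 tcm_ge0 tcm_sigma_additive.

Let behead_pair (x : n.+1.-tuple T) : T * n.-tuple T :=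
  (thead x, [tuple of behead x]).

Let measurable_behead_pair : measurable_fun setT behead_pair.
Proof.
apply/measurable_fun_pairP; split; first exact: measurable_tnth.
exact: measurable_behead.
Qed.

Let tcm_sigma_finite : sigma_finite setT tuple_cons_measure.
Proof.
have /sigma_finiteP[F [TF ndF Foo]] := sigma_finiteT m.
have /sigma_finiteP[G [TG ndG Goo]] := sigma_finiteT mn.
exists (fun k => behead_pair @^-1` (F k `*` G k)).
  apply/seteqP; split => // x _.
  have [i _ Fi] : (\bigcup_i F i) (thead x) by rewrite -TF.
  have [j _ Gj] : (\bigcup_i G i) [tuple of behead x] by rewrite -TG.
  exists (maxn i j) => //; split => /=.
    by move: Fi; exact/subsetPset/ndF/leq_maxl.
  by move: Gj; exact/subsetPset/ndG/leq_maxr.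
move=> k; have [mF Fk] := Foo k; have [mG Gk] := Goo k; split.
  rewrite -[X in measurable X]setTI.
  by apply: measurable_behead_pair => //; exact: measurableX.
rewrite /tuple_cons_measure /pushforward.
rewrite (_ : _ @^-1` _ = F k `*` G k); last first.
  rewrite -comp_preimage (_ : behead_pair \o cons_pair = id)//.
  apply/funext => -[x t]; rewrite /behead_pair /cons_pair/= theadE.
  by congr pair; exact/val_inj.
by rewrite product_measure1E// lte_mul_pinfty// ge0_fin_numE.
Qed.

HB.instance Definition _ := Measure_isSigmaFinite.Build _ _ _
  tuple_cons_measure tcm_sigma_finite.

End tuple_product_measure.

(* The n-fold product of m; the 0-fold product is the unit mass at [tuple]. *)
Fixpoint tuple_measure d (T : measurableType d) (R : realType)
    (m : {sigma_finite_measure set T -> \bar R}) n :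
    {sigma_finite_measure set (n.-tuple T) -> \bar R} :=
  if n is n'.+1 then tuple_cons_measure m (tuple_measure m n') else
  @dirac _ (0.-tuple T) [tuple] R.

Section tuple_measure_box.
Local Open Scope ereal_scope.
Context d (T : measurableType d) (R : realType).
Variable m : {sigma_finite_measure set T -> \bar R}.

Lemma measurable_tuple_box n (I : 'I_n -> set T) :
  (forall i, measurable (I i)) ->
  measurable [set x : n.-tuple T | forall i, I i (tnth x i)].
Proof.
move=> mI.
rewrite (_ : mkset _ = \bigcap_(i in [set: 'I_n]) ((@tnth n T)^~ i @^-1` I i)).
  apply: fin_bigcap_measurable => // i _.
  by rewrite -[X in measurable X]setTI; exact: measurable_tnth.
by apply/seteqP; split => x /= xI i => [_|]; exact: xI.
Qed.

Lemma tuple_measure_box_gt0 n (I : 'I_n -> set T) :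
  (forall i, measurable (I i)) -> (forall i, 0 < m (I i)) ->
  0 < tuple_measure m n [set x : n.-tuple T | forall i, I i (tnth x i)].
Proof.
elim: n I => [|n IHn] I mI I0 /=.
  by rewrite diracE mem_set//= => -[].
rewrite /tuple_cons_measure /pushforward.
rewrite (_ : _ @^-1` _ = I ord0 `*`
    [set y : n.-tuple T | forall i, I (lift ord0 i) (tnth y i)]); last first.
  apply/seteqP; split => -[x y]/=.
    move=> h; split => [|i]; first exact: (h ord0).
    by have := h (lift ord0 i); rewrite tnthS.
  move=> [xI yI] i; case: (unliftP ord0 i) => [j ->|->//].
  by rewrite tnthS.
rewrite product_measure1E//; last exact: (measurable_tuple_box (fun i => mI _)).
by apply: mule_gt0; [exact: I0|exact: (IHn (fun i => I (lift ord0 i)))].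
Qed.

End tuple_measure_box.

Section complex_euclidean_space.
Context (R : realType) (d : nat).
Implicit Types z w : 'rV[R[i]]_d.

(* C^d is identified with R^(d + d) by listing first the real parts, then the
   imaginary parts, of the coordinates. *)
Definition complex_row (x : (d + d).-tuple (measurableTypeR R)) : 'rV[R[i]]_d :=
  \row_j (tnth x (lshift d j) +i* tnth x (rshift d j))%C.

Definition real_tuple w : (d + d).-tuple (measurableTypeR R) :=
  [tuple match fintype.split i with
         | inl j => complex.Re (w ord0 j)
         | inr j => complex.Im (w ord0 j)
         end | i < d + d].

Lemma complex_rowK : cancel complex_row real_tuple.
Proof.
move=> x; apply: eq_from_tnth => i; rewrite tnth_mktuple.
by case: splitP => j ij; rewrite mxE/=; congr tnth; exact/val_inj.
Qed.

(* The Borel sigma-algebra of C^d, i.e. that of R^(d + d) transported along the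
   identification above. *)
HB.instance Definition _ := Measurable.copy 'rV[R[i]]_d
  (g_sigma_algebra_preimageType real_tuple).

Lemma measurable_complex_row : measurable_fun [set: _] complex_row.
Proof.
move=> _ _ [B mB <-]; rewrite !setTI -comp_preimage.
by rewrite (_ : _ \o _ = id)//; apply/funext => x; exact: complex_rowK.
Qed.

Definition lebesgueC : set 'rV[R[i]]_d -> \bar R :=
  pushforward (tuple_measure (@lebesgue_measure R) (d + d)) complex_row.

Let lebesgueC0 : lebesgueC set0 = 0%E.
Proof. by rewrite /lebesgueC /pushforward preimage_set0 measure0. Qed.

Let lebesgueC_ge0 A : (0 <= lebesgueC A)%E.
Proof. by rewrite /lebesgueC /pushforward; exact: measure_ge0. Qed.

Let lebesgueC_sigma_additive : semi_sigma_additive lebesgueC.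
Proof.
by apply: measure_semi_sigma_additive; exact: measurable_complex_row.
Qed.

HB.instance Definition _ := isMeasure.Build _ _ _ lebesgueC
  lebesgueC0 lebesgueC_ge0 lebesgueC_sigma_additive.

(* The norm of the library on 'rV[R[i]]_d is the maximum norm, which defines the
   same topology; the Euclidean norm is needed in the weights. *)
Definition enorm z : R :=
  Num.sqrt (\sum_j (complex.Re (z ord0 j) ^+ 2 + complex.Im (z ord0 j) ^+ 2)).

Definition hdot z w : R[i] := \sum_j z ord0 j * (w ord0 j)^*%C.

Definition cexp (x : R[i]) : R[i] :=
  (expR (complex.Re x))%:C%C *
  (cos (complex.Im x) +i* sin (complex.Im x))%C.

Definition cintegrable (f : 'rV[R[i]]_d -> R[i]) : Prop :=
  lebesgueC.-integrable [set: _] (fun w => (complex.Re (f w))%:E) /\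
  lebesgueC.-integrable [set: _] (fun w => (complex.Im (f w))%:E).

Definition cintegral (f : 'rV[R[i]]_d -> R[i]) : R[i] :=
  ((\int[lebesgueC]_w complex.Re (f w)) +i*
   (\int[lebesgueC]_w complex.Im (f w)))%C.

(* Differentiability is over the scalar field R[i], hence holomorphy on C^d. *)
Definition entire (F : 'rV[R[i]]_d -> R[i]) : Prop :=
  forall z, differentiable F z.

Definition weight (s t r : R) z : R :=
  expR (- t * enorm z ^+ 2 + r * enorm z `^ s^-1).

Definition wnorm (s t r : R) (F : 'rV[R[i]]_d -> R[i]) : \bar R :=
  Lnorm lebesgueC +oo%E (fun z => (Normc.normc (F z) * weight s t r z)%:E).

Lemma weight_ge0 s t r z : 0 <= weight s t r z.
Proof. exact: expR_ge0. Qed.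

Lemma weight_gt0 s t r z : 0 < weight s t r z.
Proof. exact: expR_gt0. Qed.

Lemma normc_ge0 (x : R[i]) : 0 <= Normc.normc x.
Proof. by case: x => a b; exact: sqrtr_ge0. Qed.

Lemma normcE (x : R[i]) : `|x| = (Normc.normc x)%:C%C.
Proof. by []. Qed.

Lemma normcD (x y : R[i]) :
  Normc.normc (x + y) <= Normc.normc x + Normc.normc y.
Proof. by rewrite -lecR rmorphD -!normcE ler_normD. Qed.

Lemma lebesgueC_gt0 z (U : set 'rV[R[i]]_d) :
  nbhs z U -> measurable U -> (0 < lebesgueC U)%E.
Proof.
move=> /nbhs_ballP[[e e']/=]; rewrite ltcE/= => /andP[/eqP -> e0] zU mU.
pose I (i : 'I_(d + d)) : set (measurableTypeR R) :=
  `]tnth (real_tuple z) i - e / 2, tnth (real_tuple z) i + e / 2[%classic.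
have mI i : measurable (I i) by exact: measurable_itv.
have I0 i : (0 < lebesgue_measure (I i))%E.
  rewrite lebesgue_measure_itv/= lte_fin ifT; last first.
    by rewrite ltrBlDr -addrA ltrDl addr_gt0// divr_gt0.
  by rewrite -EFinD lte_fin subr_gt0 ltrBlDr -addrA ltrDl addr_gt0// divr_gt0.
apply: (lt_le_trans (tuple_measure_box_gt0 mI I0)).
apply: le_measure; rewrite ?inE.
- exact: measurable_tuple_box.
- by rewrite -[X in measurable X]setTI; exact: measurable_complex_row.
move=> x/= xI; apply: zU; split=> [|i j]; first by rewrite ltcR.
rewrite ord1 /ball/= mxE.
have := xI (lshift d j); have := xI (rshift d j).
rewrite /I/= !tnth_mktuple !in_itv/=.
case: splitP => k; first by move/eqP; rewrite gtn_eqF//= ltn_addr.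
move=> /= /addnI /val_inj <- {k}.
case: splitP => k; last by move/eqP; rewrite ltn_eqF//= ltn_addr.
move=> /= /val_inj <- {k} yI xxI.
rewrite normcE ltcR; case: (z ord0 j) yI xxI => a b/= bI aI.
have sqr_lt (p q : R) : p - e / 2 < q < p + e / 2 ->
    (p - q) ^+ 2 < (e / 2) ^+ 2.
  by move=> /andP[? ?]; rewrite -subr_gt0 subr_sqr mulr_gt0//; lra.
have {aI bI} := ltrD (sqr_lt _ _ aI) (sqr_lt _ _ bI) => /lt_le_trans abI.
rewrite -[ltRHS]gtr0_norm// -sqrtr_sqr ltr_sqrt ?exprn_gt0// abI//.
by have := sqr_ge0 e; rewrite expr_div_n; lra.
Qed.

Lemma lebesgueCT_gt0 : (0 < lebesgueC [set: 'rV[R[i]]_d])%E.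
Proof. by apply: (@lebesgueC_gt0 0) => //; exact: filterT. Qed.

Lemma wnormE s t r F : wnorm s t r F =
  ess_sup lebesgueC (fun z => (Normc.normc (F z) * weight s t r z)%:E).
Proof.
rewrite /wnorm unlock lebesgueCT_gt0; apply: eq_ess_sup; apply: nearW => z /=.
by rewrite ger0_norm// mulr_ge0// ?normc_ge0// weight_ge0.
Qed.

Lemma wnormD s t r F G :
  (wnorm s t r (F + G)%R <= wnorm s t r F + wnorm s t r G)%E.
Proof.
rewrite !wnormE; apply: le_trans (ess_supD _ _ _).
apply: le_ess_sup; apply: nearW => z /=.
by rewrite -EFinD lee_fin -mulrDl ler_wpM2r ?weight_ge0// normcD.
Qed.

Lemma wnormZ s t r (a : R[i]) F :
  wnorm s t r (a *: F) = ((Normc.normc a)%:E * wnorm s t r F)%E.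
Proof.
rewrite !wnormE -ess_supZl ?lebesgueCT_gt0 ?normc_ge0//.
apply: eq_ess_sup; apply: nearW => z /=.
by rewrite -EFinM mulrA -Normc.normcM.
Qed.

Lemma wnorm0 s t r : wnorm s t r 0 = 0%E.
Proof.
by rewrite -(scale0r (0 : 'rV[R[i]]_d -> R[i])) wnormZ Normc.normc0 mul0e.
Qed.

Lemma wnorm_ge0 s t r F : (0 <= wnorm s t r F)%E.
Proof. exact: Lnorm_ge0. Qed.

Lemma le_wnorm s t r r' F : r <= r' -> (wnorm s t r F <= wnorm s t r' F)%E.
Proof.
move=> rr'; rewrite !wnormE; apply: le_ess_sup; apply: nearW => z /=.
rewrite lee_fin ler_wpM2l ?normc_ge0// ler_expR lerD2l ler_wpM2r//.
exact: powR_ge0.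
Qed.

Lemma entireD F G : entire F -> entire G -> entire (F + G).
Proof. by move=> eF eG z; exact: differentiableD. Qed.

Lemma entireZ (a : R[i]) F : entire F -> entire (a *: F).
Proof. by move=> eF z; exact: differentiableZ. Qed.

Lemma entire0 : entire 0.
Proof. by move=> z; exact: differentiable_cst. Qed.

Lemma wnorm_eq0 s t r F : entire F -> wnorm s t r F = 0%E -> F = 0.
Proof.
move=> eF; rewrite wnormE => F0; apply/funext => z; apply/eqP/negPn/negP => Fz0.
have := ess_sup_ge lebesgueC
  (fun z => (Normc.normc (F z) * weight s t r z)%:E).
rewrite F0 => -[N [mN N0 FN]].
suff /lebesgueC_gt0 /(_ mN) : nbhs z N by rewrite N0 ltxx.
have : \forall y \near z, F y != 0.
  exact: (cvgr_neq0 _ (differentiable_continuous (eF z))).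
apply: filterS => y Fy0; apply: FN => /=; apply/negP; rewrite -ltNge lte_fin.
rewrite mulr_gt0 ?weight_gt0// lt0r normc_ge0 andbT.
by apply: contra Fy0 => /eqP/Normc.eq0_normc ->.
Qed.

Definition Apred (s t r : R) : {pred 'rV[R[i]]_d -> R[i]} :=
  mem [set F | entire F /\ (wnorm s t r F < +oo)%E].

End complex_euclidean_space.

Section normed_spaces.
Context (R : realType) (d : nat) (s t : R).
Local Notation V := ('rV[R[i]]_d -> R[i]).

Lemma Apred_submod r : GRing.submod_closed (Apred (d := d) s t r).
Proof.
split=> [|a F G]; rewrite !inE/=.
  by split; [exact: entire0|rewrite wnorm0].
move=> [eF F_lty] [eG G_lty]; split.
  exact: (entireD (entireZ a eF) eG).
apply: (le_lt_trans (wnormD _ _ _ _ _)); rewrite lte_add_pinfty// wnormZ.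
by rewrite lte_mul_pinfty// ?lee_fin ?normc_ge0.
Qed.

HB.instance Definition _ r :=
  GRing.isSubmodClosed.Build _ _ (Apred (d := d) s t r) (Apred_submod r).

(* The library makes Aspace a normed (hence topological) space through
   Lmodule_isNormed below; its norm is R[i]-valued because the scalar field
   is R[i]. *)
Definition Aspace r : Type := {F : V | F \in Apred s t r}.

HB.instance Definition _ r := SubType.on (Aspace r).
HB.instance Definition _ r := [Choice of Aspace r by <:].
HB.instance Definition _ r := [SubChoice_isSubLmodule of Aspace r by <:].

Definition Anorm r (F : Aspace r) : R[i] := (fine (wnorm s t r (val F)))%:C%C.

Lemma wnorm_fin_num r (F : Aspace r) : wnorm s t r (val F) \is a fin_num.
Proof.
by rewrite ge0_fin_numE ?wnorm_ge0//; have := valP F; rewrite inE => -[].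
Qed.

Let AnormD r (F G : Aspace r) : Anorm (F + G) <= Anorm F + Anorm G.
Proof.
rewrite -rmorphD lecR -fineD ?wnorm_fin_num// fine_le ?wnorm_fin_num//.
  by rewrite fin_numD !wnorm_fin_num.
exact: wnormD.
Qed.

Let AnormZ r (a : R[i]) (F : Aspace r) : Anorm (a *: F) = `|a| * Anorm F.
Proof. by rewrite normcE -rmorphM /Anorm wnormZ fineM ?wnorm_fin_num. Qed.

Let Anorm_eq0 r (F : Aspace r) : Anorm F = 0 -> F = 0.
Proof.
move=> [F0]; apply/val_inj/(@wnorm_eq0 _ _ s t r).
  by have := valP F; rewrite inE => -[].
by rewrite -[LHS]fineK ?wnorm_fin_num// F0.
Qed.

HB.instance Definition _ r := Lmodule_isNormed.Build R[i] (Aspace r)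
  (@AnormD r) (@AnormZ r) (@Anorm_eq0 r).

End normed_spaces.

(* The requirements of PreTopologicalLmod_isTvs, for a topology T on E that need
   not be the canonical one. *)
Definition lc_vector_topology (K : numFieldType) (E : lmodType K)
    (T : Topological E) : Prop :=
  let ET := Topological.Pack T in
  [/\ continuous (fun p : ET * ET => (p.1 : E) + (p.2 : E) : ET),
      continuous (fun p : K^o * ET => p.1 *: (p.2 : E) : ET) &
      exists2 B : set_system ET,
        (forall b, b \in B -> convex_set (b : set (convex_lmodType E))) &
        basis B].

(* The two limits of the spaces Aspace d s t (rho r), r > 0, which are used with
   rho r = r and rho r = - r. *)
Section limit_spaces.
Context (R : realType) (d : nat) (s t : R) (rho : R -> R).
Local Notation V := ('rV[R[i]]_d -> R[i]).

Definition proj_pred : {pred V} :=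
  mem [set F | forall r : {posnum R}, F \in Apred s t (rho r%:num)].

Definition ind_pred : {pred V} :=
  mem [set F | exists r : {posnum R}, F \in Apred s t (rho r%:num)].

Lemma proj_pred_submod : GRing.submod_closed proj_pred.
Proof.
split=> [|a F G]; rewrite !inE/=; first by move=> r; exact: rpred0.
by move=> AF AG r; rewrite rpredD ?rpredZ ?AF ?AG.
Qed.

Lemma Apred_le r r' (F : V) :
  r <= r' -> F \in Apred s t r' -> F \in Apred s t r.
Proof.
move=> rr'; rewrite !inE => -[eF F_lty]; split=> //.
exact: le_lt_trans (le_wnorm _ _ _ rr') F_lty.
Qed.

Lemma ind_pred_submod : GRing.submod_closed ind_pred.
Proof.
split=> [|a F G]; rewrite !inE/=; first by exists 1%:pos; exact: rpred0.
move=> [p Fp] [q Gq]; have [pq|qp] := leP (rho p%:num) (rho q%:num).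
  by exists p; rewrite rpredD ?rpredZ//; exact: Apred_le Gq.
by exists q; rewrite rpredD ?rpredZ//; exact: Apred_le (ltW qp) Fp.
Qed.

HB.instance Definition _ :=
  GRing.isSubmodClosed.Build _ _ proj_pred proj_pred_submod.
HB.instance Definition _ :=
  GRing.isSubmodClosed.Build _ _ ind_pred ind_pred_submod.

Definition proj_space : Type := {F : V | F \in proj_pred}.

HB.instance Definition _ := SubType.on proj_space.
HB.instance Definition _ := [Choice of proj_space by <:].
HB.instance Definition _ := [SubChoice_isSubLmodule of proj_space by <:].

Definition ind_space : Type := {F : V | F \in ind_pred}.

HB.instance Definition _ := SubType.on ind_space.
HB.instance Definition _ := [Choice of ind_space by <:].
HB.instance Definition _ := [SubChoice_isSubLmodule of ind_space by <:].

Lemma proj_incl_subproof (r : {posnum R}) (F : proj_space) :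
  val F \in Apred s t (rho r%:num).
Proof. by have := valP F; rewrite inE; exact. Qed.

Definition proj_incl (r : {posnum R}) (F : proj_space) :
  Aspace d s t (rho r%:num) := Sub (val F) (proj_incl_subproof r F).

Lemma ind_incl_subproof (r : {posnum R}) (F : Aspace d s t (rho r%:num)) :
  val F \in ind_pred.
Proof. by rewrite inE/=; exists r; exact: valP. Qed.

Definition ind_incl (r : {posnum R}) (F : Aspace d s t (rho r%:num)) :
  ind_space := Sub (val F) (ind_incl_subproof F).

(* Projective limit: the coarsest topology for which the inclusions into the
   spaces Aspace d s t (rho r) are continuous. *)
HB.instance Definition _ := Topological.copy proj_space
  (sup_topology (fun r : {posnum R} =>
    Topological.on (initial_topology (proj_incl r)))).

(* Inductive limit of locally convex spaces: the finest locally convex vector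
   topology for which the inclusions of the spaces Aspace d s t (rho r) are
   continuous. As the supremum of the topologies with these properties has them
   again, it is the topology generated by all their open sets (sup_topology
   itself cannot be indexed by them, for universe reasons). *)
Definition ind_admissible (T : Topological ind_space) : Prop :=
  lc_vector_topology T /\
  forall r : {posnum R}, continuous (@ind_incl r : _ -> Topological.Pack T).

Definition ind_subbase : set_system ind_space :=
  [set U : set ind_space | exists2 T : Topological ind_space,
     ind_admissible T & @open (Topological.Pack T) U].

HB.instance Definition _ :=
  isSubBaseTopological.Build ind_space ind_subbase id.

End limit_spaces.

Notation calA0 d s t := (proj_space d s t id).
Notation calA' d s t := (proj_space d s t -%R).
Notation calA d s t := (ind_space d s t id).
Notation calA0' d s t := (ind_space d s t -%R).

Section anti_wick.
Context (R : realType) (d : nat).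
Local Notation V := ('rV[R[i]]_d -> R[i]).
Implicit Types (a F : V) (z w : 'rV[R[i]]_d).

Definition Op_integrand a F z w : R[i] := a w * F w * cexp (hdot (z - w) w).

Definition Op_aw a F : V :=
  fun z => ((pi : R)%:C%C) ^- d * cintegral (Op_integrand a F z).

(* A class in L^oo_loc is given by a Borel representative; hence growth_le below
   bounds it almost everywhere. *)
Definition Linfty_loc a : Prop :=
  [/\ measurable_fun [set: _] (fun w => complex.Re (a w)),
      measurable_fun [set: _] (fun w => complex.Im (a w)) &
      forall K : set 'rV[R[i]]_d, compact K ->
        (Lnorm (@lebesgueC R d) +oo (fun w => (Normc.normc (a w) * \1_K w)%:E)
         < +oo)%E].

Definition growth_le (s r : R) a : Prop :=
  exists C : R, {ae @lebesgueC R d, forall w,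
    Normc.normc (a w) <= C * expR (r * enorm w `^ s^-1)}.

(* The operator a defines is a continuous map from E1 to E2, where i1 and i2
   embed E1 and E2 into the functions on C^d. The first clause says that the
   defining integral converges absolutely (a divergent one has a default value
   in the library). *)
Definition Op_continuous a (E1 E2 : topologicalType) (i1 : E1 -> V)
    (i2 : E2 -> V) : Prop :=
  (forall (G : E1) z, cintegrable (Op_integrand a (i1 G) z)) /\
  exists2 T : E1 -> E2, (forall G, i2 (T G) = Op_aw a (i1 G)) & continuous T.

End anti_wick.

(* Main.v *)
Require Import Defs.
From HB Require Import structures.
From mathcomp Require Import all_boot all_order all_algebra finmap ring lra.
From mathcomp Require Import all_classical all_reals all_analysis.
From mathcomp Require Import measurable_realfun ess_sup_inf complex.

(* With p = 1/s < 2 and c = 1/(2(1-t0)), completing the square gives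
     Re (z-w,w) + t0|w|^2 = t1|z|^2 - (1-t0)|w-cz|^2,
   so the integrand is dominated by e^{t1|z|^2} times a Gaussian in w centred
   at cz, times e^{(r0-rho)|w|^p}.  As |w|^p and |cz|^p are comparable up to a
   multiple of |w-cz|^p, which the Gaussian absorbs because p < 2, the factor
   e^{(r0-rho)|w|^p} becomes e^{-tau|z|^p}.  Integrating the Gaussian, whose mass
   does not depend on its centre, shows that the operator is bounded from the
   space with weight (t0,rho) to the space with weight (t1,tau); the four
   continuity statements are four choices of (r0,rho,tau).
   Holomorphy in z follows from the quadratic bound on e^x - 1 - x under the
   integral sign, the Gaussian absorbing the factor e^{2d|w|} that arises. *)

Set Implicit Arguments.
Unset Strict Implicit.
Unset Printing Implicit Defensive.

Import Order.TTheory GRing.Theory Num.Theory.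
Import numFieldNormedType.Exports.

Local Open Scope classical_set_scope.
Local Open Scope ring_scope.

(** * Continuity on projective and inductive limits *)

Lemma continuous_initial (S : choiceType) (U T : topologicalType) (f : S -> T)
    (g : U -> initial_topology f) : continuous (f \o g) -> continuous g.
Proof.
move=> fg x A; rewrite nbhsE => -[_ [[B oB <-] Bx] BA].
by apply: filterS BA _; apply: fg; exact: open_nbhs_nbhs.
Qed.

Lemma continuous_sup (S : choiceType) (I : Type) (Tc : I -> Topological S)
    (U : topologicalType) (g : U -> sup_topology Tc) :
  (forall i, continuous (g : U -> Topological.Pack (Tc i))) -> continuous g.
Proof. by move=> gc x; apply/cvg_sup => i; exact: gc. Qed.

(** A supremum of topologies is finer than each of its members, so continuity for one member
    suffices. *)
Lemma sup_topology_continuous (S : choiceType) (I : Type)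
    (Tc : I -> Topological S) (i : I) (T : topologicalType) (g : S -> T) :
  continuous (g : Topological.Pack (Tc i) -> T) ->
  continuous (g : sup_topology Tc -> T).
Proof.
move=> gc x; apply: cvg_trans (gc x); apply: cvg_app.
by have /cvg_sup := @cvg_id _ (nbhs (x : sup_topology Tc)); exact.
Qed.

Section limit_continuity.
Context (R : realType) (d : nat) (s t s' t' : R) (rho rho' : R -> R).

Lemma proj_incl_continuous (r : {posnum R}) :
  continuous (@proj_incl R d s t rho r).
Proof.
apply: (@sup_topology_continuous (proj_space d s t rho) _ _ r).
exact: initial_continuous.
Qed.

(** The universal property of the projective limit reduces continuity to each component [r'], and
    that component is assumed to factor through a single step [r] of the source. *)
Lemma proj_space_continuous
    (T : proj_space d s t rho -> proj_space d s' t' rho') :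
  (forall r' : {posnum R}, exists r : {posnum R},
    exists2 L : Aspace d s t (rho r%:num) -> Aspace d s' t' (rho' r'%:num),
      continuous L & forall F, L (proj_incl r F) = proj_incl r' (T F)) ->
  continuous T.
Proof.
move=> TL.
apply: (@continuous_sup (proj_space d s' t' rho') _ _ (proj_space d s t rho)).
move=> r'; have [r [L cL LT]] := TL r'.
apply: continuous_initial.
rewrite (_ : _ \o T = L \o proj_incl r); last first.
  exact/funext/(fun F => esym (LT F)).
by move=> x; apply: continuous_comp; [exact: proj_incl_continuous|exact: cL].
Qed.

Lemma convex_set_preimage (K : numFieldType) (E1 E2 : lmodType K)
    (f : {linear E1 -> E2}) (B : set (convex_lmodType E2)) :
  convex_set B -> convex_set (f @^-1` B : set (convex_lmodType E1)).
Proof.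
move=> Bconvex x y l; rewrite !inE/= => Bx By.
have := Bconvex (f x) (f y) l; rewrite !inE => /(_ Bx By).
by congr B; rewrite /conv/= linearD !linearZ.
Qed.

(** Since [f] commutes with the vector operations, their continuity can be checked after applying
    [f]; preimages of a base of convex sets form a base of convex sets. This is the pullback step
    for inductive limits. *)
Lemma initial_lc_vector_topology (K : numFieldType) (E1 E2 : lmodType K)
    (f : {linear E1 -> E2}) (T : Topological E2) :
  lc_vector_topology T ->
  lc_vector_topology
    (Topological.on (initial_topology (f : E1 -> Topological.Pack T))).
Proof.
set f' : _ -> Topological.Pack T := f; pose W := initial_topology f'.
have cf : continuous (f' : W -> _) by exact: initial_continuous.
move=> [Tadd Tscale [B Bconvex [Bopen Bbase]]]; split.
- apply: continuous_initial => -[x y].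
  rewrite (_ : _ \o _ = (fun p : Topological.Pack T * Topological.Pack T =>
     (p.1 : E2) + (p.2 : E2) : Topological.Pack T) \o
     (fun p : W * W => (f' p.1, f' p.2))); last first.
    by apply/funext => p /=; rewrite /f' linearD.
  apply: continuous_comp; last exact: Tadd.
  by apply: cvg_pair; (apply: continuous_comp; last exact: cf);
    [exact: cvg_fst|exact: cvg_snd].
- apply: continuous_initial => -[x y].
  rewrite (_ : _ \o _ = (fun p : K^o * Topological.Pack T =>
     p.1 *: (p.2 : E2) : Topological.Pack T) \o
     (fun p : K^o * W => (p.1, f' p.2))); last first.
    by apply/funext => p /=; rewrite /f' linearZ.
  apply: continuous_comp; last exact: Tscale.
  apply: (@cvg_pair (K^o * W)%type K^o (Topological.Pack T)
    (nbhs ((x, y) : K^o * W)) (nbhs (x : K^o)) (nbhs (f' y)) _ _ _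
    fst (f' \o snd)); first exact: cvg_fst.
  by apply: (@cvg_comp _ _ _ snd f' _ (nbhs (y : W)));
    [exact: cvg_snd|exact: cf].
- exists [set f' @^-1` b | b in B].
    move=> _ /[!inE]/= -[b Bb <-].
    by apply/convex_set_preimage/Bconvex; rewrite inE.
  split=> [_ [b /Bopen ob <-]|x A]; first by exists b.
  rewrite nbhsE => -[_ [[C oC <-] Cx] CA].
  have [|b [Bb bx] bC] := Bbase (f' x) C; first exact: open_nbhs_nbhs.
  by exists (f' @^-1` b) => //=; [split => //; exists b|move=> y /bC /CA].
Qed.

(** The pullback along [T] of an admissible topology of the target is admissible on the source: it
    is locally convex by linearity, and [T] composed with an inclusion is an inclusion composed with
    a continuous [L]. Hence [T] pulls subbasic open sets back to subbasic open sets. *)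
Lemma ind_space_continuous
    (T : {linear ind_space d s t rho -> ind_space d s' t' rho'}) :
  (forall r : {posnum R}, exists r' : {posnum R},
    exists2 L : Aspace d s t (rho r%:num) -> Aspace d s' t' (rho' r'%:num),
      continuous L & forall F, T (ind_incl F) = ind_incl (L F)) ->
  continuous T.
Proof.
move=> TL.
have subbaseT U : @ind_subbase R d s' t' rho' U ->
    @ind_subbase R d s t rho (T @^-1` U).
  move=> [Top [Tlc Tincl] oU].
  exists (Topological.on
    (initial_topology (T : _ -> Topological.Pack Top))); last by exists U.
  split=> [|r]; first exact: initial_lc_vector_topology.
  apply: continuous_initial; have [r' [L cL LT]] := TL r.
  rewrite (_ : _ \o _ = (@ind_incl _ _ _ _ rho' r' : _ -> Topological.Pack Top)
    \o L); last exact/funext.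
  by move=> x; apply: continuous_comp; [exact: cL|exact: Tincl].
pose E1 : topologicalType := ind_space d s t rho.
pose E2 : topologicalType := ind_space d s' t' rho'.
apply: (proj2 (@continuousP E1 E2 T)) => _ [B sB <-].
(* An open set is a union of finite intersections of subbasic sets, so it is enough to find a
   neighbourhood of [x] inside the preimage of one such intersection [C]. *)
rewrite (@openE E1) => x [C BC Cx].
have E1x : Filter (@nbhs E1 E1 x) by exact: nbhs_filter.
apply: (@filterS _ _ E1x (T @^-1` C)); first by move=> y Cy; exists C.
have [D DE IDC] := sB _ BC; rewrite -IDC preimage_bigcap.
apply: filter_bigI => U UD; apply: (@open_nbhs_nbhs E1); split; last first.
  by move: Cx; rewrite /= -IDC; exact.
have /[!inE] sU := DE _ UD.
exists [set T @^-1` U]; last by rewrite bigcup_set1.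
move=> _ ->; exists [fset T @^-1` U]%fset.
  by move=> ? /[!inE] ->; exact: subbaseT.
by rewrite set_fset1 bigcap_set1.
Qed.

End limit_continuity.

(** * Gaussian integrals *)

Section gaussian.
Context {R : realType}.
Local Notation mu := (@lebesgue_measure R).

(** The integrand is a constant multiple of the normal density of mean [m] and variance [1/(2e)], so
    its integral is the inverse of the peak of the density, whatever [m] is. *)
Lemma integral_gaussian (e : R) : 0 < e -> exists A : R, 0 <= A /\
  forall m : R, (\int[mu]_x (expR (- e * (x - m) ^+ 2))%:E = A%:E)%E.
Proof.
move=> e0; pose sigma := Num.sqrt ((2 * e)^-1).
have ve0 : 0 < (2 * e)^-1 by rewrite invr_gt0 mulr_gt0.
have sigma0 : sigma != 0 by rewrite gt_eqF// sqrtr_gt0.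
have peak0 : normal_peak sigma != 0 by rewrite gt_eqF// normal_peak_gt0.
exists (normal_peak sigma)^-1; split; first by rewrite invr_ge0 normal_peak_ge0.
move=> m.
under eq_integral => x _.
  rewrite (_ : expR _ = (normal_peak sigma)^-1 * normal_pdf m sigma x); last first.
    rewrite normal_pdfE//= mulKf// /normal_fun sqr_sqrtr ?ltW//; congr expR.
    by rewrite mulr2n; field; rewrite gt_eqF.
  rewrite EFinM; over.
rewrite integralZl//=; last exact: integrable_normal_pdf.
by rewrite integral_normal_pdf mule1.
Qed.

(** Induction on [n]: Tonelli's theorem splits off the first coordinate. For [n = 0] the measure is
    a unit mass and the empty product is 1. *)
Lemma integral_tuple_prod n (A : R) (f : 'I_n -> R -> R) :
  (forall i, measurable_fun [set: measurableTypeR R] (f i)) ->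
  (forall i x, 0 <= f i x) ->
  (forall i, \int[mu]_x (f i x)%:E = A%:E)%E ->
  (\int[tuple_measure mu n]_x (\prod_i f i (tnth x i))%:E = (A ^+ n)%:E)%E.
Proof.
elim: n f => [|n IHn] f mf f0 intf.
  rewrite /=.
  under eq_integral do rewrite big_ord0.
  by rewrite integral_dirac//= diracT mul1e expr0.
have A0 : 0 <= A.
  by rewrite -lee_fin -(intf ord0); apply: integral_ge0 => x _; rewrite lee_fin.
have mprod k (g : 'I_k -> R -> R) :
    (forall i, measurable_fun [set: measurableTypeR R] (g i)) ->
    measurable_fun [set: _] (fun x : k.-tuple (measurableTypeR R) =>
      (\prod_i g i (tnth x i))%:E).
  move=> mg; apply/measurable_EFinP; apply: measurable_prod => i _.
  by apply: measurableT_comp => //; exact: measurable_tnth.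
rewrite /= /tuple_cons_measure ge0_integral_pushforward//; first last.
- by move=> x _; rewrite lee_fin prodr_ge0.
- exact: mprod.
- exact: measurable_cons.
rewrite preimage_setT fubini_tonelli1//=; first last.
- by move=> x; rewrite lee_fin prodr_ge0.
- by apply: measurableT_comp; [exact: mprod|exact: measurable_cons].
rewrite /fubini_F /=.
transitivity (\int[mu]_x ((f ord0 x)%:E * (A ^+ n)%:E))%E.
  apply: eq_integral => x _.
  rewrite -(IHn (fun i => f (lift ord0 i)))//.
  rewrite -ge0_integralZl//=.
  - apply: eq_integral => y _; rewrite -EFinM big_ord_recl.
    congr ((f ord0 _ * _)%:E).
    by apply: eq_bigr => i _; rewrite tnthS.
  - exact: (mprod _ (fun i => f (lift ord0 i))).
  - by move=> y _; rewrite lee_fin prodr_ge0.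
  - by rewrite lee_fin.
rewrite ge0_integralZr//=.
- by rewrite intf -EFinM exprS.
- exact/measurable_EFinP.
- by move=> x _; rewrite lee_fin.
- by rewrite lee_fin exprn_ge0.
Qed.

End gaussian.

(** * Borel functions on C^d *)

Section measurable_complex_space.
Context {R : realType} {d : nat}.
Local Notation Cd := 'rV[R[i]]_d.

Lemma normc_geRe (x : R[i]) : `|complex.Re x| <= Normc.normc x.
Proof. by rewrite -lecR; exact: normc_ge_Re. Qed.

Lemma normc_geIm (x : R[i]) : `|complex.Im x| <= Normc.normc x.
Proof.
case: x => a b /=; rewrite -sqrtr_sqr ler_wsqrtr// lerDr; exact: sqr_ge0.
Qed.

Lemma normc_le (x : R[i]) :
  Normc.normc x <= `|complex.Re x| + `|complex.Im x|.
Proof.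
case: x => a b /=; rewrite -[leRHS]ger0_norm ?addr_ge0// -sqrtr_sqr ler_wsqrtr//.
rewrite sqrrD !real_normK ?num_real//.
by have : 0 <= `|a| * `|b| by []; lra.
Qed.

Lemma measurable_real_tuple : measurable_fun [set: Cd] (@real_tuple R d).
Proof. by move=> _ B mB; exists B. Qed.

(** The ball is that of the maximum norm, and the modulus of a coordinate is at most the sum of the
    absolute values of its real and imaginary parts; hence [e / 2]. *)
Lemma real_tuple_ball (z y : Cd) (e : R) : 0 < e ->
  (forall i, `|tnth (real_tuple z) i - tnth (real_tuple y) i| < e / 2) ->
  ball z e%:C%C y.
Proof.
move=> e0 zy; split=> [|i j]; first by rewrite ltcR.
rewrite ord1 /ball/=. rewrite Defs.normcE ltcR.
have := zy (rshift d j); have := zy (lshift d j).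
rewrite !tnth_mktuple (unsplitK (inl j)) (unsplitK (inr j)).
rewrite -!raddfB => zyRe zyIm; apply: (le_lt_trans (normc_le _)).
by rewrite [e in _ < e]splitr ltrD.
Qed.

(** The sigma-algebra is transported from real tuples, so its link with the topology needs proof: an
    open set is the countable union of the rational boxes that it contains. *)
Lemma open_measurableC (G : set Cd) : open G -> measurable G.
Proof.
move=> oG; pose I (q : rat * rat) : set (measurableTypeR R) :=
  `]ratr q.1, ratr q.2[%classic.
pose box (q : (d + d).-tuple (rat * rat)) : set Cd :=
  @real_tuple R d @^-1` [set x | forall i, I (tnth q i) (tnth x i)].
have mbox q : measurable (box q).
  rewrite -[box q]setTI; apply: measurable_real_tuple => //.
  apply: (measurable_tuple_box (I := fun i => I (tnth q i))) => i.
  exact: measurable_itv.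
rewrite (_ : G = \bigcup_q (if `[< box q `<=` G >] then box q else set0)).
  apply: countable_bigcupT_measurable => // q.
  by case: ifP => // _; exact: measurable0.
apply/seteqP; split=> [w Gw|w [q _]]; last by case: asboolP => // qG /qG.
have /nbhs_ballP[[e e']/=] : nbhs w G by exact: open_nbhs_nbhs.
rewrite ltcE/= => /andP[/eqP -> e0] eG.
have /choice[q qP] (i : 'I_(d + d)) : exists q : rat * rat,
    [/\ tnth (real_tuple w) i - e / 2 < ratr q.1,
        I q (tnth (real_tuple w) i) &
        ratr q.2 < tnth (real_tuple w) i + e / 2].
  set x := tnth _ _; have e20 : 0 < e / 2 by rewrite divr_gt0.
  have /rat_in_itvoo[a /andP[ea ax]] : x - e / 2 < x by rewrite ltrBlDr ltrDl.
  have /rat_in_itvoo[b /andP[xb be]] : x < x + e / 2 by rewrite ltrDl.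
  by exists (a, b); split => //; rewrite /I/= in_itv/=; apply/andP.
exists [tuple q i | i < d + d] => //.
rewrite ifT; first by move=> i; rewrite tnth_mktuple; have [] := qP i.
apply/asboolP => y qy; apply: eG; apply: real_tuple_ball => // i.
have := qy i; rewrite tnth_mktuple /I/= in_itv/= => /andP[ay yb].
have [ea _ be] := qP i.
move: ay yb ea be; set x := tnth _ i; set z := tnth _ i => ay yb ea be.
by rewrite ltr_norml; apply/andP; split; lra.
Qed.

(* Measurability for functions with values in R[i], which the library does not
   make a measurable type. *)
Definition cmeasurable (f : Cd -> R[i]) :=
  measurable_fun [set: Cd] (fun w => complex.Re (f w)) /\
  measurable_fun [set: Cd] (fun w => complex.Im (f w)).

Lemma continuous_cmeasurable (f : Cd -> R[i]) : continuous f -> cmeasurable f.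
Proof.
move=> cf.
(* Real and imaginary parts are treated together, as additive maps bounded by the modulus; the
   preimage of an open ray is then open. *)
suff h (p : R[i] -> R) : (forall x y, p (x - y) = p x - p y) ->
    (forall x, `|p x| <= Normc.normc x) -> measurable_fun setT (p \o f).
  by split; apply: h => *; rewrite ?raddfB ?normc_geRe ?normc_geIm.
move=> pB ple; apply: (measurability _ (RGenOInfty.measurableE R)).
move=> /= _ [_ [a ->]] <-; rewrite setTI; apply: open_measurableC.
rewrite openE => w /=; rewrite in_itv/= andbT => afw.
have e0 : 0 < (p (f w) - a)%:C%C :> R[i] by rewrite ltcR subr_gt0.
have /cvgrPdist_lt /(_ _ e0) := cf w; apply: filterS => y.
rewrite Defs.normcE ltcR /= in_itv/= andbT => /(le_lt_trans (ple _)).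
by rewrite pB ltr_norml => /andP[_]; rewrite ltrD2l ltrN2.
Qed.

Lemma cmeasurable_cst (c : R[i]) : cmeasurable (fun=> c).
Proof. by split; exact: measurable_cst. Qed.

Lemma cmeasurableD f g : cmeasurable f -> cmeasurable g ->
  cmeasurable (fun w => f w + g w).
Proof.
move=> [f1 f2] [g1 g2]; split.
  by under eq_fun do rewrite raddfD; exact: measurable_funD.
by under eq_fun do rewrite raddfD; exact: measurable_funD.
Qed.

Lemma ReM (x y : R[i]) : complex.Re (x * y) =
  complex.Re x * complex.Re y - complex.Im x * complex.Im y.
Proof. by case: x; case: y. Qed.

Lemma ImM (x y : R[i]) : complex.Im (x * y) =
  complex.Re x * complex.Im y + complex.Im x * complex.Re y.
Proof. by case: x; case: y => *. Qed.

Lemma cmeasurableM f g : cmeasurable f -> cmeasurable g ->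
  cmeasurable (fun w => f w * g w).
Proof.
move=> [f1 f2] [g1 g2]; split.
  by under eq_fun do rewrite ReM; apply: measurable_funB; exact: measurable_funM.
by under eq_fun do rewrite ImM; apply: measurable_funD; exact: measurable_funM.
Qed.

Lemma cmeasurable_sum (I : Type) (r : seq I) (f : I -> Cd -> R[i]) :
  (forall i, cmeasurable (f i)) -> cmeasurable (fun w => \sum_(i <- r) f i w).
Proof.
move=> mf; elim: r => [|i r IHr].
  by under eq_fun do rewrite big_nil; exact: cmeasurable_cst.
by under eq_fun do rewrite big_cons; exact: cmeasurableD.
Qed.

Lemma cmeasurable_conj f : cmeasurable f -> cmeasurable (fun w => (f w)^*%C).
Proof.
move=> [f1 f2]; split.
  rewrite (_ : (fun w => _) = (fun w => complex.Re (f w)))//.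
  by apply/funext => w; case: (f w).
rewrite (_ : (fun w => _) = (fun w => - complex.Im (f w))); last first.
  by apply/funext => w; case: (f w).
exact: measurable_funN.
Qed.

Lemma cmeasurable_cexp f : cmeasurable f -> cmeasurable (fun w => cexp (f w)).
Proof.
move=> [f1 f2]; rewrite /cexp; apply: cmeasurableM; split=> /=.
- exact: measurableT_comp.
- exact: measurable_cst.
- by apply: measurableT_comp f2; apply: continuous_measurable_fun;
    exact: continuous_cos.
- by apply: measurableT_comp f2; apply: continuous_measurable_fun;
    exact: continuous_sin.
Qed.

Lemma cmeasurable_coord j : cmeasurable (fun w : Cd => w ord0 j).
Proof.
split.
  have -> : (fun w : Cd => complex.Re (w ord0 j)) =
      (fun x => tnth x (lshift d j)) \o @real_tuple R d.
    by apply/funext => w /=; rewrite tnth_mktuple (unsplitK (inl j)).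
  by apply: measurableT_comp measurable_real_tuple; exact: measurable_tnth.
have -> : (fun w : Cd => complex.Im (w ord0 j)) =
    (fun x => tnth x (rshift d j)) \o @real_tuple R d.
  by apply/funext => w /=; rewrite tnth_mktuple (unsplitK (inr j)).
by apply: measurableT_comp measurable_real_tuple; exact: measurable_tnth.
Qed.

End measurable_complex_space.

(** * Complex-valued integrals *)

Section complex_integral.
Context {R : realType} {d : nat}.
Local Notation Cd := 'rV[R[i]]_d.
Local Notation mu := (@lebesgueC R d).

Lemma enorm_sqr (z : Cd) : enorm z ^+ 2 =
  \sum_j (complex.Re (z ord0 j) ^+ 2 + complex.Im (z ord0 j) ^+ 2).
Proof. by rewrite sqr_sqrtr// sumr_ge0// => j _; rewrite addr_ge0 ?sqr_ge0. Qed.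

Lemma enorm_ge0 (z : Cd) : 0 <= enorm z.
Proof. exact: sqrtr_ge0. Qed.

Lemma measurable_enormB (m : Cd) :
  measurable_fun [set: Cd] (fun w => enorm (w - m)).
Proof.
rewrite (_ : (fun w => _) = Num.sqrt \o (fun w : Cd => \sum_j
  (complex.Re ((w - m) ord0 j) ^+ 2 + complex.Im ((w - m) ord0 j) ^+ 2)))//.
apply: measurableT_comp.
  by apply: continuous_measurable_fun; exact: sqrt_continuous.
apply: measurable_sum => j.
have [mRe mIm] : cmeasurable (fun w : Cd => (w - m) ord0 j).
  under eq_fun do rewrite !mxE.
  exact: cmeasurableD (cmeasurable_coord j) (cmeasurable_cst _).
by apply: measurable_funD; exact: measurable_funX.
Qed.

Lemma measurable_gaussianC (e : R) (m : Cd) :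
  measurable_fun [set: Cd] (fun w => expR (- e * enorm (w - m) ^+ 2)).
Proof.
apply: measurableT_comp => //; apply: measurable_funM => //.
by apply: measurable_funX; exact: measurable_enormB.
Qed.

(** In the [d + d] real coordinates the Gaussian is a product of one-dimensional Gaussians, each of
    a mass that does not depend on its centre. *)
Lemma integral_gaussianC (e : R) : 0 < e -> exists2 A : R, 0 <= A &
  forall m : Cd, (\int[mu]_w (expR (- e * enorm (w - m) ^+ 2))%:E = A%:E)%E.
Proof.
move=> /integral_gaussian[A [A0 intA]]; exists (A ^+ (d + d)).
  by rewrite exprn_ge0.
move=> m; rewrite ge0_integral_pushforward//.
- rewrite preimage_setT.
  pose f (i : 'I_(d + d)) x := expR (- e * (x - tnth (real_tuple m) i) ^+ 2).
  rewrite -(@integral_tuple_prod R (d + d) A f)//.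
  + apply: eq_integral => x _ /=; rewrite /f -expR_sum -mulr_sumr.
    rewrite big_split_ord/= -big_split/= enorm_sqr; congr (expR (_ * _))%:E.
    apply: eq_bigr => j _; rewrite !mxE/= !tnth_mktuple.
    rewrite (unsplitK (inl j)) (unsplitK (inr j)).
    by case: (m ord0 j).
  + move=> i; apply: measurableT_comp => //; apply: measurable_funM => //.
    by apply: measurable_funX; exact: measurable_funB.
  + by move=> i x; exact: expR_ge0.
  + by move=> i; exact: intA.
- exact: measurable_complex_row.
- by have /measurable_EFinP := measurable_gaussianC e m.
Qed.

Lemma cintegrable_le (f : Cd -> R[i]) (g : Cd -> R) : cmeasurable f ->
  mu.-integrable [set: _] (EFin \o g) ->
  {ae mu, forall w, Normc.normc (f w) <= g w} -> cintegrable f.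
Proof.
move=> [mRe mIm] /integrableP[mg gfin] fg.
suff h (p : R[i] -> R) : measurable_fun setT (p \o f) ->
    (forall x, `|p x| <= Normc.normc x) -> mu.-integrable setT (EFin \o (p \o f)).
  by split; apply: h => // x; [exact: normc_geRe|exact: normc_geIm].
move=> mp ple; apply/integrableP; split; first exact/measurable_EFinP.
apply: le_lt_trans gfin; apply: ae_ge0_le_integral => //.
- by apply: measurableT_comp => //; exact/measurable_EFinP.
- exact: measurableT_comp.
apply: filterS fg => w fgw _ /=; rewrite lee_fin.
by rewrite (le_trans (ple _))// (le_trans fgw)// ler_norm.
Qed.

(** Real and imaginary parts of the integral are bounded separately, which costs the factor 2. *)
Lemma normc_cintegral_le (f : Cd -> R[i]) (g : Cd -> R) : cmeasurable f ->
  mu.-integrable [set: _] (EFin \o g) -> (forall w, 0 <= g w) ->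
  {ae mu, forall w, Normc.normc (f w) <= g w} ->
  Normc.normc (cintegral f) <= 2 * \int[mu]_w g w.
Proof.
move=> mf ig g0 fg; have [mRe mIm] := mf; have [iRe iIm] := cintegrable_le mf ig fg.
apply: (le_trans (normc_le _)); rewrite /= mulr2n mulrDl mul1r.
suff h (p : R[i] -> R) : mu.-integrable setT (EFin \o (p \o f)) ->
    (forall x, `|p x| <= Normc.normc x) ->
    `|\int[mu]_w p (f w)| <= \int[mu]_w g w.
  by apply: lerD; apply: h => // x; [exact: normc_geRe|exact: normc_geIm].
move=> ip ple; apply: (le_trans (le_normr_Rintegral _ ip)) => //.
have /integrableP[mp pfin] := ip; have /integrableP[mg gfin] := ig.
rewrite /Rintegral; apply: fine_le.
- by rewrite ge0_fin_numE ?integral_ge0.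
- exact: integrable_fin_num.
apply: ae_ge0_le_integral => //.
- do 2 apply: measurableT_comp => //; exact/measurable_EFinP.
- by move=> w _; rewrite lee_fin.
by apply: filterS fg => w fgw _ /=; rewrite lee_fin (le_trans (ple _)).
Qed.

Lemma cintegralD (f g : Cd -> R[i]) : cintegrable f -> cintegrable g ->
  cintegral (fun w => f w + g w) = cintegral f + cintegral g.
Proof.
move=> [f1 f2] [g1 g2]; rewrite /cintegral.
under eq_Rintegral do rewrite raddfD.
rewrite RintegralD//; congr (_ +i* _)%C.
by under eq_Rintegral do rewrite raddfD; rewrite RintegralD.
Qed.

Lemma cintegrableD (f g : Cd -> R[i]) : cintegrable f -> cintegrable g ->
  cintegrable (fun w => f w + g w).
Proof.
move=> [f1 f2] [g1 g2]; split.
  under eq_fun do rewrite raddfD EFinD; exact: integrableD.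
under eq_fun do rewrite raddfD EFinD; exact: integrableD.
Qed.

Lemma cintegrableZ (c : R[i]) (f : Cd -> R[i]) : cintegrable f ->
  cintegrable (fun w => c * f w).
Proof.
move=> [f1 f2]; split.
  under eq_fun do rewrite ReM EFinB !EFinM.
  by apply: integrableB => //; exact: integrableZl.
under eq_fun do rewrite ImM EFinD !EFinM.
by apply: integrableD => //; exact: integrableZl.
Qed.

Lemma cintegralZ (c : R[i]) (f : Cd -> R[i]) : cintegrable f ->
  cintegral (fun w => c * f w) = c * cintegral f.
Proof.
move=> [f1 f2].
have Zl k (g : Cd -> R) : mu.-integrable setT (EFin \o g) ->
    mu.-integrable setT (EFin \o (fun w => k * g w)).
  move=> ig; rewrite (_ : _ \o _ = fun w => k%:E * (g w)%:E)%E//.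
  exact: integrableZl.
apply/eqP; rewrite eq_complex ReM ImM /cintegral/=; apply/andP; split; apply/eqP.
  under eq_Rintegral do rewrite ReM.
  by rewrite RintegralB ?RintegralZl//; exact: Zl.
under eq_Rintegral do rewrite ImM.
by rewrite RintegralD ?RintegralZl//; exact: Zl.
Qed.

Lemma cintegral_sum (I : Type) (r : seq I) (f : I -> Cd -> R[i]) :
  (forall i, cintegrable (f i)) ->
  cintegrable (fun w => \sum_(i <- r) f i w) /\
  cintegral (fun w => \sum_(i <- r) f i w) = \sum_(i <- r) cintegral (f i).
Proof.
move=> fi; elim: r => [|i r [IHi IHe]].
  have -> : (fun w : Cd => \sum_(j <- [::]) f j w) = (fun=> 0).
    by apply/funext => w; rewrite big_nil.
  split; first by split; exact: integrable0.
  by rewrite big_nil /cintegral /= !Rintegral_cst// !mul0r.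
have -> : (fun w => \sum_(j <- i :: r) f j w) =
    (fun w => f i w + \sum_(j <- r) f j w).
  by apply/funext => w; rewrite big_cons.
by rewrite big_cons cintegralD// IHe; split => //; exact: cintegrableD.
Qed.

End complex_integral.

(** * The complex exponential *)

Section exponential_remainder.
Context {R : realType}.
Implicit Types a b : R.

(** This is [1 - a <= expR (- a)] multiplied by [expR a]. *)
Lemma expR_sub1_le a : expR a - 1 <= a * expR a.
Proof.
have := expR_ge1Dx (- a); rewrite expRN => h.
rewrite -subr_ge0 (_ : _ - _ = expR a * ((expR a)^-1 - (1 - a))).
  by rewrite mulr_ge0 ?expR_ge0// subr_ge0.
by rewrite mulrBr divff ?gt_eqF ?expR_gt0//; ring.
Qed.

Lemma normr_expR_sub1 a : `|expR a - 1| <= `|a| * expR `|a|.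
Proof.
have [a0|/ltW a0] := leP 0 a.
  by rewrite !ger0_norm ?expR_sub1_le// subr_ge0 -expR0 ler_expR.
rewrite ler0_norm ?subr_le0 -?expR0 ?ler_expR// expR0 opprB.
apply: (@le_trans _ _ `|a|); last first.
  by rewrite ler_peMr// -expR0 ler_expR.
by rewrite ler0_norm//; have := expR_ge1Dx a; lra.
Qed.

(** For every real [a] the remainder lies between 0 and [a * (expR a - 1)]. *)
Lemma normr_expR_sub1D a : `|expR a - 1 - a| <= a ^+ 2 * expR `|a|.
Proof.
rewrite ger0_norm; last by have := expR_ge1Dx a; lra.
apply: (@le_trans _ _ (`|a| * `|expR a - 1|)).
  rewrite -normrM (le_trans _ (ler_norm _))//.
  by have := expR_sub1_le a; lra.
by rewrite -real_normK ?num_real// expr2 -mulrA ler_wpM2l// normr_expR_sub1.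
Qed.

Lemma normr_sin_le b : `|sin b| <= `|b|.
Proof.
wlog b0 : b / 0 < b.
  move=> h; have [/h//|b0|<-] := ltgtP 0 b; last by rewrite sin0.
  by rewrite -normrN -sinN -[leRHS]normrN h// oppr_gt0.
have [|c _] := @MVT R sin cos 0 b b0 (fun x _ => is_derive_sin x).
  by apply: continuous_subspaceT => x; exact: continuous_sin.
rewrite sin0 !subr0 => ->; rewrite normrM ler_piMl//.
by rewrite ler_norml cos_geN1 cos_le1.
Qed.

Lemma cosB1E b : cos b - 1 = - (2 * sin (b / 2) ^+ 2).
Proof.
rewrite {1}(_ : b = (b / 2) *+ 2); last by rewrite -mulr_natr; field.
by rewrite cos_mulr2n cos2sin2; ring.
Qed.

Lemma normr_cosB1 b : `|cos b - 1| <= b ^+ 2.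
Proof.
rewrite cosB1E normrN normrM normrX.
have := normr_sin_le (b / 2); rewrite -(ler_sqr _ _)//.
rewrite normrM (ger0_norm (_ : 0 <= 2^-1))// exprMn real_normK ?num_real//.
rewrite real_normK ?num_real// (ger0_norm (_ : 0 <= 2))// => h.
have := sqr_ge0 b; lra.
Qed.

(** In the half-angle formula one sine factor is bounded by 1 and the other by half of [|b|]. *)
Lemma normr_cosB1_lin b : `|cos b - 1| <= `|b|.
Proof.
rewrite cosB1E normrN normrM normrX expr2 ger0_norm//.
have h := normr_sin_le (b / 2); rewrite normrM (ger0_norm (_ : 0 <= 2^-1)) in h => //.
have h1 : `|sin (b / 2)| <= 1 by rewrite ler_norml sin_geN1 sin_le1.
have := ler_wpM2r (normr_ge0 (sin (b / 2))) h1; lra.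
Qed.

(** Mean value theorem for [sin x - x], whose derivative [cos x - 1] has the linear bound above;
    oddness reduces to positive [b]. *)
Lemma normr_sinB b : `|sin b - b| <= b ^+ 2.
Proof.
wlog b0 : b / 0 < b.
  move=> h; have [/h//|b0|<-] := ltgtP 0 b; last by rewrite sin0 subr0 normr0 expr0n.
  by rewrite -normrN opprB addrC -sinN -[X in _ + X]opprK -sqrrN h// oppr_gt0.
have [|c] := @MVT R (fun x => sin x - x) (fun x => cos x - 1) 0 b b0
  (fun x _ => is_deriveB (is_derive_sin x) (is_derive_id x 1)).
  apply: continuous_subspaceT => x.
  by apply: cvgB; [exact: continuous_sin|exact: cvg_id].
rewrite in_itv/= => /andP[c0 cb]; rewrite sin0 !subr0 => ->.
rewrite normrM expr2 (gtr0_norm b0) ler_wpM2r ?(ltW b0)//.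
by rewrite (le_trans (normr_cosB1_lin _))// gtr0_norm// ltW.
Qed.

Lemma cexpD (x y : R[i]) : cexp (x + y) = cexp x * cexp y.
Proof.
rewrite /cexp !raddfD/= expRD rmorphM/= mulrACA; congr (_ * _).
by rewrite cosD sinD; apply/eqP; rewrite eq_complex ReM ImM/= addrC eqxx/= addrC.
Qed.

Lemma normc_cexp (x : R[i]) : Normc.normc (cexp x) = expR (complex.Re x).
Proof.
rewrite /cexp Normc.normcM /= cos2Dsin2 sqrtr1 mulr1 expr0n addr0 sqrtr_sqr.
by rewrite ger0_norm// expR_ge0.
Qed.

(** For [x = a + ib] of modulus [n], the real part is [e^a (cos b - 1) + (e^a - 1 - a)], at most
    [n^2 e^n], and the imaginary part is [(e^a - 1) sin b + (sin b - b)], at most [2 n^2 e^n]; hence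
    the constant 3. *)
Lemma normc_cexp_remainder (x : R[i]) : Normc.normc (cexp x - 1 - x) <=
  3 * Normc.normc x ^+ 2 * expR (Normc.normc x).
Proof.
apply: (le_trans (normc_le _)).
have := normc_geRe x; have := normc_geIm x.
have nE : Normc.normc x ^+ 2 = complex.Re x ^+ 2 + complex.Im x ^+ 2.
  by case: x => a b /=; rewrite sqr_sqrtr// addr_ge0 ?sqr_ge0.
move: (Normc.normc x) nE => n nE.
case: x nE => a b /= nE bn an.
have n0 : 0 <= n by exact: le_trans bn.
rewrite !mul0r subr0 addr0 oppr0 addr0.
have ean : expR `|a| <= expR n by rewrite ler_expR.
have en1 : 1 <= expR n by rewrite -expR0 ler_expR.
have eaa : expR a <= expR n by rewrite ler_expR (le_trans (ler_norm _)).
have re : `|expR a * cos b - 1 - a| <= n ^+ 2 * expR n.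
  rewrite (_ : _ - a = expR a * (cos b - 1) + (expR a - 1 - a)); last by ring.
  apply: (le_trans (ler_normD _ _)); rewrite normrM (gtr0_norm (expR_gt0 _)).
  rewrite nE mulrDl addrC lerD//.
    by rewrite (le_trans (normr_expR_sub1D a))// ler_wpM2l ?sqr_ge0.
  by rewrite mulrC ler_pM ?expR_ge0// normr_cosB1.
have im : `|expR a * sin b - b| <= 2 * n ^+ 2 * expR n.
  rewrite (_ : _ - b = (expR a - 1) * sin b + (sin b - b)); last by ring.
  apply: (le_trans (ler_normD _ _)); rewrite normrM.
  rewrite -mulrA mulr2n mulrDl mul1r lerD//.
    apply: (@le_trans _ _ ((n * expR n) * n)).
      apply: ler_pM => //; last exact: le_trans (normr_sin_le _) _.
      by apply: (le_trans (normr_expR_sub1 _)); rewrite ler_pM ?expR_ge0.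
    by rewrite mulrAC expr2.
  apply: (le_trans (normr_sinB _)); rewrite (@le_trans _ _ (n ^+ 2))//.
    by rewrite nE lerDr sqr_ge0.
  by rewrite ler_peMr ?sqr_ge0.
by rewrite (le_trans (lerD re im))//; lra.
Qed.

End exponential_remainder.

(** * Comparison of the weights *)

(** The threshold [X] solves [e X^(2-p) = K]: beyond it the quadratic term dominates, and up to it
    the left side is at most the constant [K X^p]. *)
Lemma powR_le_sqr (R : realType) (p e K : R) : 0 <= p -> p < 2 -> 0 < e ->
  0 <= K -> exists C : R, forall x, 0 <= x -> K * x `^ p <= e * x ^+ 2 + C.
Proof.
move=> p0 p2 e0 K0; pose X := (K / e) `^ (2 - p)^-1.
have Xp : X `^ (2 - p) = K / e.
  by rewrite -powRrM mulVf ?gt_eqF ?subr_gt0// powRr1// divr_ge0// ltW.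
exists (K * X `^ p) => x x0; have [xX|Xx] := leP x X.
  apply: (@le_trans _ _ (K * X `^ p)).
    by rewrite ler_wpM2l// ge0_ler_powR// nnegrE (le_trans x0).
  by rewrite lerDr mulr_ge0 ?sqr_ge0// ltW.
rewrite -[leLHS]addr0 lerD ?mulr_ge0 ?powR_ge0//.
have xN0 : x != 0 by rewrite gt_eqF// (le_lt_trans (powR_ge0 _ _) Xx).
have -> : K = e * X `^ (2 - p) by rewrite Xp mulrC divfK// gt_eqF.
rewrite -mulrA ler_wpM2l ?(ltW e0)//.
have -> : x ^+ 2 = x `^ (2 - p) * x `^ p.
  by rewrite -powRD ?xN0 ?implybT// subrK powR_mulrn.
rewrite ler_wpM2r ?powR_ge0// ge0_ler_powR ?nnegrE ?powR_ge0 ?(ltW Xx)//.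
by rewrite subr_ge0 ltW.
Qed.

Section enorm_inequalities.
Context {R : realType} {d : nat}.
Implicit Types z w : 'rV[R[i]]_d.

Lemma enormZ (c : R) z : 0 <= c -> enorm (c%:C%C *: z) = c * enorm z.
Proof.
move=> c0; rewrite /enorm -[in RHS](ger0_norm c0) -sqrtr_sqr -sqrtrM ?sqr_ge0//.
congr Num.sqrt; rewrite mulr_sumr; apply: eq_bigr => j _.
by rewrite mxE ReM ImM/=; ring.
Qed.

Lemma enormN z : enorm (- z) = enorm z.
Proof.
congr Num.sqrt; apply: eq_bigr => j _; rewrite mxE.
by rewrite !raddfN/= !sqrrN.
Qed.

Lemma enorm_sqrD_le z w :
  enorm (z + w) ^+ 2 <= 2 * enorm z ^+ 2 + 2 * enorm w ^+ 2.
Proof.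
rewrite !enorm_sqr !mulr_sumr -big_split/=; apply: ler_sum => j _.
rewrite mxE; move: (z ord0 j) (w ord0 j) => [a b] [a' b']/=.
have := sqr_ge0 (a - a'); have := sqr_ge0 (b - b'); lra.
Qed.

(* A factor 2 replaces the triangle inequality, so that Cauchy-Schwarz is not
   needed. *)
Lemma enormD_le_max z w : enorm (z + w) <= 2 * Num.max (enorm z) (enorm w).
Proof.
have m0 : 0 <= Num.max (enorm z) (enorm w) by rewrite le_max enorm_ge0.
rewrite -ler_sqr ?nnegrE ?enorm_ge0 ?mulr_ge0//.
apply: (le_trans (enorm_sqrD_le _ _)).
have : enorm z ^+ 2 <= Num.max (enorm z) (enorm w) ^+ 2.
  by rewrite ler_sqr ?nnegrE ?enorm_ge0// le_max lexx.
have : enorm w ^+ 2 <= Num.max (enorm z) (enorm w) ^+ 2.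
  by rewrite ler_sqr ?nnegrE ?enorm_ge0// le_max lexx orbT.
rewrite exprMn; lra.
Qed.

Lemma enormD_le z w : enorm (z + w) <= 2 * enorm z + 2 * enorm w.
Proof.
rewrite (le_trans (enormD_le_max _ _))// -mulrDr ler_wpM2l// ge_max.
by rewrite lerDl lerDr !enorm_ge0.
Qed.

(** Passing through the maximum of the two norms gives one argument for all [p >= 0], with no case
    distinction between concave and convex powers. *)
Lemma enormD_powR_le (p : R) z w : 0 <= p ->
  enorm (z + w) `^ p <= 2 `^ p * (enorm z `^ p + enorm w `^ p).
Proof.
move=> p0; have m0 : 0 <= Num.max (enorm z) (enorm w).
  by rewrite le_max enorm_ge0.
apply: (@le_trans _ _ ((2 * Num.max (enorm z) (enorm w)) `^ p)).
  by rewrite ge0_ler_powR ?nnegrE ?enorm_ge0 ?mulr_ge0// enormD_le_max.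
rewrite powRM// ler_wpM2l ?powR_ge0//.
by have [_|_] := leP (enorm z) (enorm w); [rewrite lerDr|rewrite lerDl];
  exact: powR_ge0.
Qed.

(** As [Re (z-w,w) = Re (z,w) - |w|^2], the left side is, coordinate by coordinate, a quadratic
    polynomial in [w] with leading coefficient [-(1-t)]. *)
Lemma complete_square (t : R) z w : t < 1 ->
  complex.Re (hdot (z - w) w) + t * enorm w ^+ 2 =
  (4 * (1 - t))^-1 * enorm z ^+ 2 -
  (1 - t) * enorm (w - ((2 * (1 - t))^-1)%:C%C *: z) ^+ 2.
Proof.
move=> t1; have t1N0 : 1 - t != 0 by rewrite subr_eq0 gt_eqF.
rewrite !enorm_sqr /hdot raddf_sum !mulr_sumr -sumrB -big_split/=.
apply: eq_bigr => j _; rewrite !mxE.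
move: (z ord0 j) (w ord0 j) => [a b] [a' b']/=.
by field.
Qed.

(* With u = w - c z, the constants come from |c z|^p <= 2^p (|w|^p + |u|^p) when
   kappa >= 0, and from |w|^p <= 2^p (|c z|^p + |u|^p) when kappa <= 0. *)
Definition weight_transfer (p t kappa tau : R) : Prop :=
  let c := (2 * (1 - t))^-1 in
  0 <= kappa /\ tau * 2 `^ p <= kappa * c `^ p \/
  kappa <= 0 /\ tau <= kappa * (2 `^ p * c `^ p).

(** Replacing [|w|^p] by [|z|^p] costs a multiple of [|u|^p]. Half of the Gaussian decay in [u]
    absorbs this term, and the other half is left for the integration over [w]. *)
Lemma weight_transfer_le (p t kappa tau : R) : 0 <= p -> p < 2 -> t < 1 ->
  weight_transfer p t kappa tau -> exists C : R, forall z w,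
  complex.Re (hdot (z - w) w) + t * enorm w ^+ 2 - kappa * enorm w `^ p <=
  (4 * (1 - t))^-1 * enorm z ^+ 2 - tau * enorm z `^ p + C -
  (1 - t) / 2 * enorm (w - ((2 * (1 - t))^-1)%:C%C *: z) ^+ 2.
Proof.
move=> p0 p2 t1; rewrite /weight_transfer; set c := (2 * (1 - t))^-1 => kt.
have c0 : 0 <= c by rewrite invr_ge0 mulr_ge0// subr_ge0 ltW.
have K0 : 0 <= `|kappa| * 2 `^ p by rewrite mulr_ge0 ?powR_ge0.
have e0 : 0 < (1 - t) / 2 by rewrite divr_gt0// subr_gt0.
have [C HC] := powR_le_sqr p0 p2 e0 K0; exists C => z w.
rewrite complete_square// -/c; set u := w - _.
rewrite -!(mulNr tau) -!(mulNr kappa).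
suff : - kappa * enorm w `^ p <=
    - tau * enorm z `^ p + `|kappa| * 2 `^ p * enorm u `^ p.
  have := HC _ (enorm_ge0 u); move: (`|kappa| * 2 `^ p * _) (_ * enorm z ^+ 2).
  move: (- tau * _ `^ p) => A B D; move: (enorm u ^+ 2) (_ * enorm w `^ p).
  by move=> E F; lra.
have czE : enorm (c%:C%C *: z) `^ p = c `^ p * enorm z `^ p.
  by rewrite enormZ// powRM// enorm_ge0.
have two1 : 1 <= 2 `^ p :> R by rewrite -[leLHS](powRr0 (2 : R)) ler_powR// ler1n.
have zp0 := powR_ge0 (enorm z) p; have up0 := powR_ge0 (enorm u) p.
case: kt => -[k0 kt].
  have h : c `^ p * enorm z `^ p <=
      2 `^ p * (enorm w `^ p + enorm u `^ p).
    rewrite -czE -(enormN u) (_ : _ *: z = w - u); last first.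
      by rewrite opprB addrC subrK.
    exact: enormD_powR_le.
  rewrite (ger0_norm k0).
  move: zp0 up0 two1 kt h; move: (enorm z `^ p) (enorm w `^ p) (enorm u `^ p).
  move: (2 `^ p) (c `^ p) => P cp Z W U Z0 U0 P1 kt h.
  (* Multiplying by [P = 2^p] avoids a division; the error term then has coefficient [P] where [P^2]
     is allowed, and [P >= 1]. *)
  rewrite -(@ler_pM2l _ P) ?(lt_le_trans _ P1)//.
  have h1 := ler_wpM2l k0 h; have h2 := ler_wpM2r Z0 kt.
  have h3 : 0 <= P - 1 by rewrite subr_ge0.
  have := mulr_ge0 (mulr_ge0 (mulr_ge0 k0 U0) h3) (le_trans ler01 P1).
  by lra.
have h : enorm w `^ p <= 2 `^ p * (c `^ p * enorm z `^ p + enorm u `^ p).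
  rewrite -czE {1}(_ : w = c%:C%C *: z + u); last by rewrite addrC subrK.
  exact: enormD_powR_le.
rewrite (ler0_norm k0); have k0' : 0 <= - kappa by rewrite oppr_ge0.
move: zp0 kt h; move: (enorm z `^ p) (enorm w `^ p) (enorm u `^ p).
move: (2 `^ p) (c `^ p) => P cp Z W U Z0 kt h.
apply: (le_trans (ler_wpM2l k0' h)).
rewrite -subr_ge0 (_ : _ - _ = kappa * (P * cp) * Z - tau * Z); last by ring.
by rewrite subr_ge0 ler_wpM2r.
Qed.

End enorm_inequalities.

(** * Holomorphic parameter integrals *)

Lemma linear_le_continuous (K : numFieldType) (V W : normedModType K)
    (f : {linear V -> W}) (C : K) : C \is Num.real ->
  (forall x, `|f x| <= C * `|x|) -> continuous f.
Proof.
move=> Creal fC; apply/bounded_linear_continuous/linear_boundedP.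
exists C; split=> // r Cr x; rewrite (le_trans (fC x))// ler_wpM2r//.
exact: ltW.
Qed.

Section entire_parameter_integral.
Context {R : realType} {d : nat}.
Local Notation Cd := 'rV[R[i]]_d.
Local Notation mu := (@lebesgueC R d).
Implicit Types (z w h : Cd) (r : R).

(** Norms of rows are elements of [R[i]]; the real number behind them lets the estimates be carried
    out in [R]. *)
Lemma normr_mx_real (h : Cd) : exists2 r : R, 0 <= r & `|h| = r%:C%C.
Proof.
have := normr_ge0 h; case: `|h| => a b; rewrite lecE/= => /andP[/eqP -> a0].
by exists a.
Qed.

Lemma normc_coord_le w j : Normc.normc (w ord0 j) <= enorm w.
Proof.
have -> : Normc.normc (w ord0 j) =
    Num.sqrt (complex.Re (w ord0 j) ^+ 2 + complex.Im (w ord0 j) ^+ 2).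
  by case: (w ord0 j).
rewrite ler_wsqrtr// (bigD1 j)//= lerDl sumr_ge0// => k _.
by rewrite addr_ge0 ?sqr_ge0.
Qed.

Lemma normc_coord_le_norm h j r :
  `|h| = r%:C%C -> Normc.normc (h ord0 j) <= r.
Proof.
move=> hr; rewrite -lecR -hr -Defs.normcE [leRHS]/Num.Def.normr/= mx_normE.
by rewrite -[leLHS]nngE num_le; exact: (le_bigmax _ _ (ord0, j)).
Qed.

Lemma normc_conj (x : R[i]) : Normc.normc (x^*%C) = Normc.normc x.
Proof. by case: x => a b /=; rewrite sqrrN. Qed.

Lemma normc_sum_le (I : Type) (s : seq I) (f : I -> R[i]) :
  Normc.normc (\sum_(i <- s) f i) <= \sum_(i <- s) Normc.normc (f i).
Proof.
elim: s => [|i s IHs]; first by rewrite !big_nil Normc.normc0.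
by rewrite !big_cons (le_trans (normcD _ _))// lerD2l.
Qed.

(** Each of the [d] terms is at most the maximum norm of [h] times the Euclidean norm of [w]. *)
Lemma normc_hdot_le h w r : `|h| = r%:C%C ->
  Normc.normc (hdot h w) <= r * (d%:R * enorm w).
Proof.
move=> hr; apply: (le_trans (normc_sum_le _ _)).
rewrite mulrCA mulr_natl -[X in _ *+ X](card_ord d) -sumr_const.
apply: ler_sum => j _; rewrite Normc.normcM normc_conj.
by apply: ler_pM; rewrite ?normc_ge0 ?normc_coord_le// (normc_coord_le_norm _ hr).
Qed.

Section coordinate_form.
Variable L : 'I_d -> R[i].

(** Used as the differential of a function whose partial derivatives are the [L j]. *)
Definition coord_form (h : Cd) : R[i] := \sum_j h ord0 j * L j.

Lemma coord_form_linear : linear coord_form.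
Proof.
move=> a x y; rewrite /coord_form scaler_sumr -big_split/=.
by apply: eq_bigr => j _; rewrite !mxE mulrDl -mulrA.
Qed.

HB.instance Definition _ := GRing.isLinear.Build _ _ _ _ coord_form
  coord_form_linear.

Lemma coord_form_continuous : continuous coord_form.
Proof.
have C0 : 0 <= \sum_j Normc.normc (L j) by apply: sumr_ge0 => j _; exact: normc_ge0.
apply: (@linear_le_continuous _ _ _ _ (\sum_j Normc.normc (L j))%:C%C).
  by rewrite ger0_real// lecR.
move=> h; have [r r0 hr] := normr_mx_real h; rewrite hr Defs.normcE -rmorphM lecR.
apply: (le_trans (normc_sum_le _ _)); rewrite mulr_suml.
apply: ler_sum => j _; rewrite Normc.normcM mulrC ler_wpM2l ?normc_ge0//.
exact: normc_coord_le_norm.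
Qed.

End coordinate_form.

Lemma differentiable_quadratic (f : Cd -> R[i]) z (L : 'I_d -> R[i]) (C : R) :
  0 <= C ->
  (forall h r, 0 <= r <= 1 -> `|h| = r%:C%C ->
    Normc.normc (f (h + z) - f z - coord_form L h) <= C * r ^+ 2) ->
  differentiable f z.
Proof.
move=> C0 fC.
have dfz : f \o shift z = cst (f z) + coord_form L +o_ 0 id.
  apply/eqaddoP => e e0.
  have [e' e'0 eE] : exists2 e', 0 < e' & e = e'%:C%C.
    by move: e0; case: e => a b; rewrite ltcE/= => /andP[/eqP -> a0]; exists a.
  (* For [r < delta] this gives [C * r <= e']; adding 1 keeps the denominator positive when
     [C = 0]. *)
  pose delta := Num.min 1 (e' / (C + 1)).
  have delta0 : 0 < delta by rewrite lt_min ltr01 divr_gt0// ltr_wpDl.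
  have delta0C : 0 < delta%:C%C :> R[i] by rewrite ltcR.
  have : \forall h \near (0 : Cd), `|h| < delta%:C%C.
    by apply/nbhs_norm0P; exists delta%:C%C.
  apply: filterS => h; have [r r0 hr] := normr_mx_real h.
  rewrite hr ltcR lt_min => /andP[r1 rC] /=.
  rewrite !fctE/= opprD addrA.
  rewrite [leRHS](_ : _ = (e' * r)%:C%C); last by rewrite eE -rmorphM.
  rewrite Defs.normcE lecR (le_trans (fC h r _ hr))//; first by rewrite r0 ltW.
  rewrite expr2 mulrA ler_wpM2r//.
  move: rC; rewrite ltr_pdivlMr ?ltr_wpDl// => /ltW; apply: le_trans.
  by rewrite mulrC ler_wpM2l// lerDl.
apply/diff_locallyP.
by rewrite (diff_unique (@coord_form_continuous L) dfz); split => //;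
  exact: coord_form_continuous.
Qed.

(** Square [x / 2 <= expR (x / 2)]. *)
Lemma sqr_le_expR (x : R) : 0 <= x -> x ^+ 2 <= 4 * expR x.
Proof.
move=> x0; have h : x / 2 <= expR (x / 2).
  by apply: le_trans (expR_ge1Dx _); rewrite lerDr.
have x20 : 0 <= x / 2 by rewrite divr_ge0.
have := lerXn2r 2 _ _ h; rewrite !nnegrE x20 expR_ge0 => /(_ isT isT).
rewrite -expRM_natl (_ : 2 * (x / 2) = x); last by field.
by rewrite expr_div_n; lra.
Qed.

Lemma le_expR (x : R) : x <= expR x.
Proof. by have := expR_ge1Dx x; lra. Qed.

(** * First-order expansion of an integral with an exponential parameter *)

Section remainder.
Variables (G : Cd -> R[i]) (g : Cd -> R).
Hypotheses (mG : cmeasurable G) (ig : mu.-integrable [set: _] (EFin \o g)).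
Hypothesis g0 : forall w, 0 <= g w.
Hypothesis Gg : {ae mu, forall w,
  Normc.normc (G w) * expR (2 * (d%:R * enorm w)) <= g w}.

Let X w := d%:R * enorm w.

Let X0 w : 0 <= X w. Proof. by rewrite mulr_ge0// enorm_ge0. Qed.

Let cintegrableG (f : Cd -> R[i]) (c : R) : 0 <= c -> cmeasurable f ->
  (forall w, Normc.normc (f w) <= c * expR (2 * X w)) ->
  cintegrable (fun w => G w * f w) /\
  Normc.normc (cintegral (fun w => G w * f w)) <= 2 * c * \int[mu]_w g w.
Proof.
move=> c0 mf fX; have mGf := cmeasurableM mG mf.
have Gfg : {ae mu, forall w, Normc.normc (G w * f w) <= c * g w}.
  apply: filterS Gg => w Gw; rewrite Normc.normcM.
  apply: (le_trans (ler_wpM2l (normc_ge0 _) (fX w))).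
  by rewrite mulrCA ler_wpM2l.
have icg : mu.-integrable [set: Cd] (EFin \o (fun w => c * g w)).
  rewrite (_ : _ \o _ = fun w => c%:E * (g w)%:E)%E//; exact: integrableZl.
split; first exact: cintegrable_le mGf icg Gfg.
rewrite -mulrA -RintegralZl//; apply: normc_cintegral_le => // w.
by rewrite mulr_ge0.
Qed.

(** The pointwise remainder is at most [3 |(h,w)|^2 e^|(h,w)|]. As [r <= 1], one factor [e^(d|w|)]
    bounds the exponential and a second one, with constant 4, bounds the square divided by [r^2];
    this uses up the factor [expR (2 * (d%:R * enorm w))] in the hypothesis on [G]. Integration
    doubles the constant 12. *)
Lemma differentiable_cexp_remainder h r : 0 <= r <= 1 -> `|h| = r%:C%C ->
  Normc.normc (cintegral (fun w => G w * cexp (hdot h w)) - cintegral G -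
    coord_form (fun j => cintegral (fun w => G w * (w ord0 j)^*%C)) h) <=
  24 * \int[mu]_w g w * r ^+ 2.
Proof.
move=> /andP[r0 r1] hr.
have mw j : cmeasurable (fun w : Cd => (w ord0 j)^*%C).
  exact/cmeasurable_conj/cmeasurable_coord.
have mh : cmeasurable (fun w => hdot h w).
  by apply: cmeasurable_sum => j; apply: cmeasurableM => //; exact: cmeasurable_cst.
have exp1 w : 1 <= expR (2 * X w).
  by rewrite -expR0 ler_expR mulr_ge0.
have iG : cintegrable G.
  have -> : G = fun w => G w * 1 by apply/funext => w; rewrite mulr1.
  apply: (proj1 (@cintegrableG (fun=> 1) 1 _ _ _)) => //.
  by move=> w; rewrite Normc.normc1 mul1r exp1.
have iGw j : cintegrable (fun w => G w * (w ord0 j)^*%C).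
  apply: (proj1 (@cintegrableG _ 1 _ _ _)) => // w.
  rewrite mul1r normc_conj (le_trans (normc_coord_le _ _))//.
  apply: (@le_trans _ _ (X w)).
    (* The existence of an index [j] rules out [d = 0], so [|w| <= d |w|]. *)
    rewrite ler_peMl ?enorm_ge0// ler1n; case: (d) j => [[]//|//].
  by rewrite (le_trans (le_expR _))// ler_expR ler_peMl// ler1n.
pose f w := cexp (hdot h w) - 1 - hdot h w.
have mf : cmeasurable f.
  rewrite /f; apply: cmeasurableD; last first.
    by under eq_fun do rewrite -mulN1r;
      apply: cmeasurableM => //; exact: cmeasurable_cst.
  by apply: cmeasurableD; [exact: cmeasurable_cexp|exact: cmeasurable_cst].
have fX w : Normc.normc (f w) <= 12 * r ^+ 2 * expR (2 * X w).
  apply: (le_trans (normc_cexp_remainder _)).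
  have nX : Normc.normc (hdot h w) <= r * X w by exact: normc_hdot_le.
  have nX1 : Normc.normc (hdot h w) <= X w.
    by rewrite (le_trans nX)// ler_piMl.
  have n2 : Normc.normc (hdot h w) ^+ 2 <= r ^+ 2 * (4 * expR (X w)).
    apply: (@le_trans _ _ ((r * X w) ^+ 2)).
      by rewrite ler_sqr ?nnegrE ?normc_ge0// mulr_ge0.
    by rewrite exprMn ler_wpM2l ?sqr_ge0// sqr_le_expR.
  have -> : 12 * r ^+ 2 * expR (2 * X w) =
      3 * (r ^+ 2 * (4 * expR (X w))) * expR (X w).
    by rewrite (_ : 2 * X w = X w + X w) ?expRD; ring.
  apply: ler_pM; rewrite ?expR_ge0 ?ler_expR//.
    by rewrite mulr_ge0 ?sqr_ge0.
  by rewrite ler_wpM2l.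
have [iGf Gfle] := cintegrableG (mulr_ge0 (ler0n R 12) (sqr_ge0 r)) mf fX.
have iZ j : cintegrable (fun w => h ord0 j * (G w * (w ord0 j)^*%C)).
  exact: cintegrableZ.
have [iS Se] := cintegral_sum (index_enum 'I_d) iZ.
(* Writing the exponential as [1 + (h,w) + f w], the first two terms integrate to exactly what is
   subtracted in the statement. *)
rewrite (_ : (fun w => G w * cexp _) = (fun w => G w +
    (\sum_j h ord0 j * (G w * (w ord0 j)^*%C) + G w * f w))); last first.
  apply/funext => w; rewrite /f.
  rewrite (_ : \sum_j _ = G w * hdot h w); first by ring.
  by rewrite mulr_sumr; apply: eq_bigr => j _; rewrite mulrCA.
rewrite cintegralD//; last exact: cintegrableD.
rewrite cintegralD// Se (_ : \sum_j _ = coord_form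
  (fun j => cintegral (fun w => G w * (w ord0 j)^*%C)) h); last first.
  by apply: eq_bigr => j _; rewrite cintegralZ.
rewrite [X in Normc.normc X](_ : _ = cintegral (fun w => G w * f w)); last by ring.
rewrite (_ : 24 * _ * _ = 2 * (12 * r ^+ 2) * \int[mu]_w g w)//; ring.
Qed.

End remainder.

End entire_parameter_integral.

(** * The anti-Wick operator *)

Section anti_wick_estimates.
Context {R : realType} {d : nat}.
Local Notation Cd := 'rV[R[i]]_d.
Local Notation mu := (@lebesgueC R d).
Implicit Types (a F : Cd -> R[i]) (z w : Cd).

Lemma wnorm_ae_le (s t r : R) F : (wnorm s t r F < +oo)%E ->
  {ae mu, forall w, Normc.normc (F w) <= fine (wnorm s t r F) *
    expR (t * enorm w ^+ 2 - r * enorm w `^ s^-1)}.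
Proof.
move=> Foo; have Ffin : wnorm s t r F \is a fin_num.
  by rewrite ge0_fin_numE// wnorm_ge0.
have := ess_sup_ge mu (fun z => (Normc.normc (F z) * weight s t r z)%:E).
rewrite -wnormE; have ME := fineK Ffin; set M := fine _ in ME *.
rewrite -ME; apply: filterS => w.
rewrite lee_fin -ler_pdivlMr ?weight_gt0// /weight -expRN.
by rewrite opprD mulNr opprK.
Qed.

Lemma wnorm_le (s t r M : R) F :
  (forall z, Normc.normc (F z) <=
    M * expR (t * enorm z ^+ 2 - r * enorm z `^ s^-1)) ->
  (wnorm s t r F <= M%:E)%E.
Proof.
move=> FM; rewrite wnormE; apply/ess_supP; apply: nearW => z.
rewrite lee_fin -ler_pdivlMr ?weight_gt0// /weight -expRN.
by rewrite opprD mulNr opprK.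
Qed.

Lemma cmeasurable_Op_integrand a F z : cmeasurable a -> cmeasurable F ->
  cmeasurable (Op_integrand a F z).
Proof.
move=> ma mF; apply: cmeasurableM; first exact: cmeasurableM.
apply: cmeasurable_cexp; apply: cmeasurable_sum => j.
apply: cmeasurableM; last exact/cmeasurable_conj/cmeasurable_coord.
under eq_fun do rewrite !mxE -mulN1r.
apply: cmeasurableD; first exact: cmeasurable_cst.
by apply: cmeasurableM; [exact: cmeasurable_cst|exact: cmeasurable_coord].
Qed.

(** A shift in [z] is a multiplication by an exponential, which brings the operator under the
    parameter integrals treated above. *)
Lemma Op_integrandD a F z h w :
  Op_integrand a F (h + z) w = Op_integrand a F z w * cexp (hdot h w).
Proof.
rewrite /Op_integrand -[RHS]mulrA -cexpD; congr (_ * cexp _).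
by rewrite /hdot -big_split/=; apply: eq_bigr => j _; rewrite !mxE; ring.
Qed.

Lemma integrable_gaussianC (e c : R) (m : Cd) : 0 < e ->
  mu.-integrable [set: _] (EFin \o (fun w => c * expR (- e * enorm (w - m) ^+ 2))).
Proof.
move=> e0; rewrite (_ : _ \o _ =
  fun w => c%:E * (expR (- e * enorm (w - m) ^+ 2))%:E)%E//.
apply: integrableZl => //; apply/integrableP; split.
  by apply/measurable_EFinP; exact: measurable_gaussianC.
under eq_integral do rewrite gee0_abs ?lee_fin ?expR_ge0//.
by have [A _ ->] := @integral_gaussianC R d _ e0; exact: ltry.
Qed.

(** * Boundedness between weighted spaces *)

Section bound.
Variables (s t r rho tau : R) (a : Cd -> R[i]).
Hypotheses (s2 : 2^-1 < s) (t1 : t < 1) (ma : cmeasurable a).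
Hypothesis ar : growth_le s r a.
Hypothesis st : weight_transfer s^-1 t (rho - r) tau.

Let p0 : 0 <= s^-1.
Proof. by rewrite invr_ge0 ltW// (lt_trans _ s2)// invr_gt0. Qed.

Let p2 : s^-1 < 2.
Proof. by rewrite -[ltRHS]invrK ltf_pV2 ?posrE ?invr_gt0// (lt_trans _ s2)// invr_gt0. Qed.

Let c := (2 * (1 - t))^-1.

Lemma Op_integrand_ae_le : exists2 B : R, 0 <= B & forall F z,
  (wnorm s t rho F < +oo)%E -> {ae mu, forall w,
    Normc.normc (Op_integrand a F z w) <= B * fine (wnorm s t rho F) *
    expR ((4 * (1 - t))^-1 * enorm z ^+ 2 - tau * enorm z `^ s^-1) *
    expR (- ((1 - t) / 2) * enorm (w - c%:C%C *: z) ^+ 2)}.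
Proof.
have [Ca aCa] := ar; have [C HC] := @weight_transfer_le R d _ _ _ _ p0 p2 t1 st.
(* [Ca] comes from the growth of the symbol, with no sign given; [C] is the additive constant in the
   exponent. Neither depends on [F] or [z]. *)
exists (`|Ca| * expR C); first by rewrite mulr_ge0 ?expR_ge0.
move=> F z Foo; apply: filterS2 aCa (wnorm_ae_le Foo) => w aw Fw.
rewrite /Op_integrand 2!Normc.normcM normc_cexp.
set M := fine _; have M0 : 0 <= M by rewrite fine_ge0// wnorm_ge0.
apply: (@le_trans _ _ (`|Ca| * expR (r * enorm w `^ s^-1) *
    (M * expR (t * enorm w ^+ 2 - rho * enorm w `^ s^-1)) *
    expR (complex.Re (hdot (z - w) w)))).
  rewrite ler_wpM2r ?expR_ge0// ler_pM ?normc_ge0//.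
  by rewrite (le_trans aw)// ler_wpM2r ?expR_ge0// ler_norm.
rewrite [leLHS](_ : _ = `|Ca| * M * expR (complex.Re (hdot (z - w) w) +
    t * enorm w ^+ 2 - (rho - r) * enorm w `^ s^-1)); last first.
  rewrite mulrBl opprB addrA !expRD !expRN; ring.
rewrite [leRHS](_ : _ = `|Ca| * M * expR ((4 * (1 - t))^-1 * enorm z ^+ 2 -
    tau * enorm z `^ s^-1 + C -
    (1 - t) / 2 * enorm (w - c%:C%C *: z) ^+ 2)); last first.
  rewrite mulNr !expRD; ring.
by rewrite ler_wpM2l ?mulr_ge0// ler_expR.
Qed.

(** The dominating Gaussian is centred at [c z] but has the same mass [A] for every [z], so
    integrating the pointwise bound gives a constant uniform in [z] and [F]. *)
Lemma Op_aw_bounded : exists2 K : R, 0 <= K & forall F, entire F ->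
  (wnorm s t rho F < +oo)%E ->
  [/\ forall z, cintegrable (Op_integrand a F z),
      entire (Op_aw a F) &
      (wnorm s (4 * (1 - t))^-1 tau (Op_aw a F) <=
        K%:E * wnorm s t rho F)%E].
Proof.
have [B B0 HB] := Op_integrand_ae_le.
have e0 : 0 < (1 - t) / 2 by rewrite divr_gt0// subr_gt0.
have [A A0 HA] := @integral_gaussianC R d _ e0.
exists (Normc.normc ((pi : R)%:C%C ^- d) * (2 * (B * A))).
  by rewrite !mulr_ge0 ?normc_ge0.
move=> F eF Foo.
have mF : cmeasurable F.
  by apply: continuous_cmeasurable => z; exact: differentiable_continuous.
have mG z := cmeasurable_Op_integrand z ma mF.
set M := fine (wnorm s t rho F).
have M0 : 0 <= M by rewrite fine_ge0// wnorm_ge0.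
pose W z := expR ((4 * (1 - t))^-1 * enorm z ^+ 2 - tau * enorm z `^ s^-1).
pose g z w := B * M * W z * expR (- ((1 - t) / 2) * enorm (w - c%:C%C *: z) ^+ 2).
have BMW z : 0 <= B * M * W z by rewrite !mulr_ge0 ?expR_ge0.
have ig z : mu.-integrable [set: _] (EFin \o g z).
  exact: integrable_gaussianC.
have Gg z := HB F z Foo.
split.
- by move=> z; exact: cintegrable_le (mG z) (ig z) (Gg z).
- move=> z; pose k := 2 * d%:R : R.
  have e40 : 0 < (1 - t) / 4 by rewrite divr_gt0// subr_gt0.
  have k0 : 0 <= k by rewrite mulr_ge0.
  (* By [|w| <= 2|w - cz| + 2|cz|], the extra factor [e^(k|w|)] costs a constant depending on [z]
     and half of the remaining Gaussian rate [(1-t)/2]; the rate [(1-t)/4] survives. *)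
  have [C HC] := @powR_le_sqr R 1 ((1 - t) / 4) (k * 2) ler01 (ltr1n _ 2) e40
    (mulr_ge0 k0 (ler0n _ 2)).
  pose D := B * M * W z * expR (k * (2 * enorm (c%:C%C *: z)) + C).
  pose g' w := D * expR (- ((1 - t) / 4) * enorm (w - c%:C%C *: z) ^+ 2).
  have D0 : 0 <= D by rewrite mulr_ge0 ?expR_ge0.
  have g'0 w : 0 <= g' w by rewrite mulr_ge0 ?expR_ge0.
  have ig' : mu.-integrable [set: _] (EFin \o g').
    exact: integrable_gaussianC.
  have Gg' : {ae mu, forall w, Normc.normc (Op_integrand a F z w) *
      expR (2 * (d%:R * enorm w)) <= g' w}.
    apply: filterS (Gg z) => w Gw.
    apply: (le_trans (ler_wpM2r (expR_ge0 _) Gw)).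
    rewrite /g' /D -!mulrA !(ler_wpM2l, expR_ge0)// -!expRD ler_expR.
    have := HC _ (enorm_ge0 (w - c%:C%C *: z)); rewrite powRr1 ?enorm_ge0//.
    have := enormD_le (w - c%:C%C *: z) (c%:C%C *: z); rewrite subrK.
    move=> /(ler_wpM2l k0); rewrite /k.
    move: (enorm w) (enorm (c%:C%C *: z)) (enorm _) => X Y U h1 h2; lra.
  have I0 : 0 <= 24 * \int[mu]_w g' w by rewrite mulr_ge0// Rintegral_ge0.
  have dOp : differentiable (fun z => cintegral (Op_integrand a F z)) z.
    apply: (differentiable_quadratic (L := fun j => cintegral (fun w =>
      Op_integrand a F z w * (w ord0 j)^*%C)) I0) => h r1 r01 hr.
    have := differentiable_cexp_remainder (mG z) ig' g'0 Gg' r01 hr.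
    rewrite (_ : (fun w => Op_integrand a F z w * cexp (hdot h w)) =
      Op_integrand a F (h + z)); first exact.
    by apply/funext => w; rewrite Op_integrandD.
  exact: (differentiableZ _ dOp).
rewrite -[wnorm s t rho F]fineK ?ge0_fin_numE ?wnorm_ge0// -/M -EFinM.
apply: wnorm_le => z; rewrite /Op_aw Normc.normcM -!mulrA ler_wpM2l ?normc_ge0//.
apply: (le_trans (normc_cintegral_le (mG z) (ig z) _ (Gg z))).
  by move=> w; rewrite mulr_ge0 ?expR_ge0.
rewrite ler_wpM2l// /g RintegralZl//.
  by rewrite /Rintegral HA/= le_eqVlt; apply/orP; left; apply/eqP; rewrite /W; ring.
have := integrable_gaussianC 1 (c%:C%C *: z) e0.
by apply: eq_integrable => // w _ /=; rewrite mul1r.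
Qed.

End bound.
End anti_wick_estimates.

(** * Continuity on the limit spaces *)

Section anti_wick_continuity.
Context {R : realType} {d : nat}.
Variables (s t : R) (a : 'rV[R[i]]_d -> R[i]).
Hypotheses (s2 : 2^-1 < s) (t1 : t < 1) (ma : cmeasurable a).

Lemma Op_aw_linear (k : R[i]) (F G : 'rV[R[i]]_d -> R[i]) :
  (forall z, cintegrable (Op_integrand a F z)) ->
  (forall z, cintegrable (Op_integrand a G z)) ->
  Op_aw a (k *: F + G) = k *: Op_aw a F + Op_aw a G.
Proof.
move=> iF iG; apply/funext => z; rewrite /Op_aw.
have -> : Op_integrand a (k *: F + G) z =
    fun w => k * Op_integrand a F z w + Op_integrand a G z w.
  apply/funext => w; rewrite /Op_integrand.
  by rewrite [X in _ * X * _](_ : _ = k * F w + G w)//; ring.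
rewrite cintegralD ?cintegralZ//; last exact: cintegrableZ.
rewrite [RHS](_ : _ = k * (pi%:C%C ^- d * cintegral (Op_integrand a F z)) +
  pi%:C%C ^- d * cintegral (Op_integrand a G z))//.
by rewrite mulrDr mulrCA.
Qed.

Lemma Aspace_entire (t' r : R) (F : Aspace d s t' r) :
  entire (val F) /\ (wnorm s t' r (val F) < +oo)%E.
Proof. by have := valP F; rewrite inE. Qed.

Lemma Op_aw_Aspace (r rho tau : R) : growth_le s r a ->
  weight_transfer s^-1 t (rho - r) tau ->
  exists L : Aspace d s t rho -> Aspace d s (4 * (1 - t))^-1 tau,
  [/\ continuous L,
      forall F, val (L F) = Op_aw a (val F) &
      forall (F : Aspace d s t rho) z, cintegrable (Op_integrand a (val F) z)].
Proof.
move=> ar st; have [K K0 HK] := Op_aw_bounded s2 t1 ma ar st.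
have iF (F : Aspace d s t rho) z : cintegrable (Op_integrand a (val F) z).
  by have [eF Foo] := Aspace_entire F; have [] := HK _ eF Foo.
have LF (F : Aspace d s t rho) :
    Op_aw a (val F) \in Apred s (4 * (1 - t))^-1 tau.
  have [eF Foo] := Aspace_entire F; have [_ eOp Ople] := HK _ eF Foo.
  rewrite inE; split => //; apply: (le_lt_trans Ople).
  by rewrite lte_mul_pinfty// lee_fin.
pose L F : Aspace d s (4 * (1 - t))^-1 tau := Sub (Op_aw a (val F)) (LF F).
have Llinear : linear L.
  by move=> k F G; apply/val_inj; rewrite /= Op_aw_linear//; exact: iF.
pose Lpack : {linear _ -> _} :=
  HB.pack L (GRing.isLinear.Build _ _ _ _ L Llinear).
exists L; split => //; apply: (@linear_le_continuous _ _ _ Lpack K%:C%C).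
  by rewrite ger0_real// lecR.
move=> F; have [eF Foo] := Aspace_entire F; have [_ eOp Ople] := HK _ eF Foo.
rewrite [leRHS](_ : _ = (K * fine (wnorm s t rho (val F)))%:C%C); last first.
  by rewrite rmorphM.
rewrite [leLHS](_ : _ = (fine (wnorm s (4 * (1 - t))^-1 tau (val (L F))))%:C%C)//.
rewrite lecR -lee_fin EFinM !fineK//; first exact: wnorm_fin_num.
exact: wnorm_fin_num.
Qed.

(** For projective limits each target index needs a source index. The growth exponent [r0] may
    depend on [r'], which covers symbols bounded for one exponent as well as for all. *)
Lemma Op_continuous_proj (rho rho' : R -> R) :
  (forall r' : {posnum R}, exists r : {posnum R}, exists2 r0, growth_le s r0 a &
    weight_transfer s^-1 t (rho r%:num - r0) (rho' r'%:num)) ->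
  @Op_continuous R d a (proj_space d s t rho)
    (proj_space d s (4 * (1 - t))^-1 rho') sval sval.
Proof.
move=> rhoP; have OpP (F : proj_space d s t rho) :
    Op_aw a (val F) \in proj_pred s (4 * (1 - t))^-1 rho'.
  rewrite inE => r'; have [r [r0 ar st]] := rhoP r'.
  have [L [_ LE _]] := Op_aw_Aspace ar st.
  by rewrite -(LE (proj_incl r F)); exact: valP.
split=> [F z|].
  (* Absolute convergence needs only one step of the limit; the index 1 is arbitrary. *)
  have [r [r0 ar st]] := rhoP 1%:pos; have [L [_ _ iL]] := Op_aw_Aspace ar st.
  exact: (iL (proj_incl r F)).
pose T (F : proj_space d s t rho) : proj_space d s (4 * (1 - t))^-1 rho' :=
  Sub (Op_aw a (val F)) (OpP F).
exists T => //; apply: proj_space_continuous => r'.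
have [r [r0 ar st]] := rhoP r'; have [L [cL LE _]] := Op_aw_Aspace ar st.
by exists r, L => // F; apply/val_inj; rewrite LE.
Qed.

(** Here each source index needs a target index. Every element of the union lies in a single step,
    where integrability and membership of the image are already known. *)
Lemma Op_continuous_ind (rho rho' : R -> R) :
  (forall r : {posnum R}, exists r' : {posnum R}, exists2 r0, growth_le s r0 a &
    weight_transfer s^-1 t (rho r%:num - r0) (rho' r'%:num)) ->
  @Op_continuous R d a (ind_space d s t rho)
    (ind_space d s (4 * (1 - t))^-1 rho') sval sval.
Proof.
move=> rhoP; have incl (F : ind_space d s t rho) :
    exists r : {posnum R}, exists F' : Aspace d s t (rho r%:num), val F' = val F.
  have := valP F; rewrite inE => -[r Fr].
  by exists r, (Sub (val F) Fr).
have iF (F : ind_space d s t rho) z : cintegrable (Op_integrand a (val F) z).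
  have [r [F' <-]] := incl F; have [r' [r0 ar st]] := rhoP r.
  by have [L [_ _ iL]] := Op_aw_Aspace ar st; exact: iL.
split=> //; have OpP (F : ind_space d s t rho) :
    Op_aw a (val F) \in ind_pred s (4 * (1 - t))^-1 rho'.
  have [r [F' <-]] := incl F; have [r' [r0 ar st]] := rhoP r.
  have [L [_ LE _]] := Op_aw_Aspace ar st.
  by rewrite inE; exists r'; rewrite -LE; exact: valP.
pose T (F : ind_space d s t rho) : ind_space d s (4 * (1 - t))^-1 rho' :=
  Sub (Op_aw a (val F)) (OpP F).
have Tlinear : linear T.
  by move=> k F G; apply/val_inj; rewrite /= Op_aw_linear//; exact: iF.
pose Tpack : {linear _ -> _} :=
  HB.pack T (GRing.isLinear.Build _ _ _ _ T Tlinear).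
exists T => //; apply: (@ind_space_continuous _ _ _ _ _ _ _ _ Tpack) => r.
have [r' [r0 ar st]] := rhoP r; have [L [cL LE _]] := Op_aw_Aspace ar st.
by exists r', L => // F; apply/val_inj; rewrite /= LE.
Qed.

End anti_wick_continuity.

Theorem proposition4p6 (R : realType) (d : nat) (s t0 t1 : R)
    (a0 : 'rV[R[i]]_d -> R[i]) :
  2^-1 < s -> Linfty_loc a0 -> 0 < t0 -> t0 < 1 -> t1 = (4 * (1 - t0))^-1 ->
  ((exists2 r0 : R, 0 < r0 & growth_le s r0 a0) ->
     @Op_continuous R d a0 (calA0 d s t0) (calA0 d s t1) sval sval /\
     @Op_continuous R d a0 (calA0' d s t0) (calA0' d s t1) sval sval) /\
  ((forall r0 : R, 0 < r0 -> growth_le s r0 a0) ->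
     @Op_continuous R d a0 (calA d s t0) (calA d s t1) sval sval /\
     @Op_continuous R d a0 (calA' d s t0) (calA' d s t1) sval sval).
Proof.
move=> s2 [mRe mIm _] t0_gt0 t0_lt1 ->.
have ma : cmeasurable a0 by [].
(* These are the constants [2^p] and [c^p] of [weight_transfer], with [p = 1/s]. *)
pose P : R := 2 `^ s^-1; pose Q : R := (2 * (1 - t0))^-1 `^ s^-1.
have P0 : 0 < P by rewrite powR_gt0.
have Q0 : 0 < Q by rewrite powR_gt0// invr_gt0 mulr_gt0// subr_gt0.
have PQ0 : 0 < P * Q by rewrite mulr_gt0.
split=> [[r0 r0_gt0 ar]|ar]; split.
(* With [r = r' P / Q + r0], [kappa = r - r0] satisfies [kappa Q = r' P]. *)
- apply: Op_continuous_proj => // r'.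
  have r_gt0 : 0 < r'%:num * P / Q + r0 by rewrite addr_gt0// divr_gt0// mulr_gt0.
  exists (PosNum r_gt0), r0 => //; left; rewrite /= addrK; split.
    by rewrite divr_ge0 ?mulr_ge0 ?ltW.
  by rewrite -/P -/Q divfK// gt_eqF.
(* Here [kappa = -(r + r0)] is negative, and [r'] is chosen so that [-r' = kappa P Q]. *)
- apply: Op_continuous_ind => // r.
  have r_gt0 : 0 < (r%:num + r0) * (P * Q) by rewrite mulr_gt0// addr_gt0.
  exists (PosNum r_gt0), r0 => //; right; rewrite /= -opprD; split.
    by rewrite oppr_le0 addr_ge0// ltW.
  by rewrite -/P -/Q mulNr.
(* The growth exponent [r / 2] leaves [kappa = r / 2], and then [r' P = kappa Q]. *)
- apply: Op_continuous_ind => // r.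
  have r2 : 0 < r%:num / 2 :> R by rewrite divr_gt0.
  have r_gt0 : 0 < r%:num / 2 * Q / P by rewrite divr_gt0 ?mulr_gt0.
  exists (PosNum r_gt0), (r%:num / 2); first exact: ar.
  left; rewrite /= -/P -/Q divfK ?gt_eqF// (_ : r%:num - _ = r%:num / 2).
    by split => //; exact: ltW.
  by field.
(* The source index and the growth exponent both equal [r' / (2 P Q)], so [kappa P Q = -r']. *)
- apply: Op_continuous_proj => // r'.
  have r_gt0 : 0 < r'%:num / (2 * (P * Q)) by rewrite divr_gt0// mulr_gt0.
  exists (PosNum r_gt0), (r'%:num / (2 * (P * Q))); first exact: ar.
  right; rewrite /= -/P -/Q -opprD; split.
    by rewrite oppr_le0 addr_ge0// ltW.
  rewrite mulNr lerN2 le_eqVlt; apply/orP; left; apply/eqP.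
  by field; rewrite !gt_eqF.
Qed.
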